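(* Let $d\geq 1$ and let $\epsilon(n)=C\left(\dfrac{\log n}{n}\right)^{2/d}$, where $$C<\frac{3(4-\lambda_d^2)}{64}\left(\frac{9}{4d^2}\right)^{1/d}.$$ Then asymptotically almost surely $\chi\left(\mathrm{Bor}^d_n(\epsilon(n))\right)\leq d+1$.
   Context: $S^d\subset\mathbb{R}^{d+1}$ is the unit sphere and $\|\cdot\|$ is the Euclidean norm of $\mathbb{R}^{d+1}$. The random Borsuk graph $\mathrm{Bor}^d_n(\epsilon)$ has as vertices $n$ independent uniformly distributed random points $X_1,\dots,X_n$ on $S^d$, with $X_i$ and $X_j$ ($i\neq j$) adjacent if and only if $\|X_i-X_j\|>2-\epsilon$. $\chi$ denotes chromatic number. An event holds asymptotically almost surely if its probability tends to $1$ as $n\to\infty$. The constant $\lambda_d$ is defined as follows: let $\Delta$ be a regular $(d+1)$-simplex inscribed in $S^d$, let $\Phi:\partial\Delta\to S^d$, $\Phi(x)=x/\|x\|$, and let $\tau$ be any facet of $\Delta$; then $\lambda_d$ is the Euclidean diameter of $\Phi(\tau)$ (independent of the facet). *)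

(* Defs.v *)
From HB Require Import structures.
From mathcomp Require Import all_boot all_order all_algebra.
From mathcomp Require Import all_classical all_reals all_analysis.

Set Implicit Arguments.
Unset Strict Implicit.
Unset Printing Implicit Defensive.

Import Order.TTheory GRing.Theory Num.Theory.
Import numFieldNormedType.Exports.

Local Open Scope classical_set_scope.
Local Open Scope ring_scope.

(* The library norm `|x| on 'rV[R]_m is the sup norm, hence a separate
   Euclidean norm. *)
Definition enorm (R : realType) (m : nat) (x : 'rV[R]_m) : R :=
  Num.sqrt (\sum_(i < m) x ord0 i ^+ 2).

Definition sphere (R : realType) (d : nat) : set 'rV[R]_d.+1 :=
  [set x | enorm x = 1].

(* Euclidean diameter. It is only meaningful on bounded sets: as [sup] is
   total, it is 0 on the empty set and on unbounded sets. *)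
Definition ediam (R : realType) (m : nat) (A : set 'rV[R]_m) : R :=
  sup [set enorm (p.1 - p.2) | p in A `*` A].

(* R^m with its Borel sigma-algebra. The sup norm and the Euclidean norm
   define the same open sets. *)
Definition borelE (R : realType) (m : nat) :=
  g_sigma_algebraType (@open 'rV[R]_m).

Definition fine_cover (R : realType) (m : nat) (delta : R) (A : set 'rV[R]_m) :
    set (nat -> set 'rV[R]_m) :=
  [set U | A `<=` \bigcup_k U k /\
    forall k x y, U k x -> U k y -> enorm (x - y) <= delta].

(* The d-dimensional Hausdorff measure for the Euclidean distance (for d >= 1),
   without the customary normalising factor, which cancels in [uniform_law]. *)
Definition hausdorff (R : realType) (m d : nat) (A : set 'rV[R]_m) : \bar R :=
  ereal_sup [set
    ereal_inf [set (\sum_(0 <= k <oo) (ediam (U k) ^+ d)%:E)%E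
              | U in fine_cover delta A]
    | delta in [set delta : R | 0 < delta]].

(* The uniform probability on S^d is the normalised surface measure, the surface
   measure on S^d being the d-dimensional Hausdorff measure. *)
Definition uniform_law (R : realType) (d : nat) (A : set 'rV[R]_d.+1) : \bar R :=
  (hausdorff d (A `&` @sphere R d) / hausdorff d (@sphere R d))%E.

Definition uniform_on_sphere (R : realType) (d : nat) (disp : measure_display)
    (T : measurableType disp) (P : probability T R)
    (X : {RV P >-> borelE R d.+1}) : Prop :=
  forall A : set (borelE R d.+1), measurable A ->
    distribution P X A = uniform_law A.

Definition independent_RVs (R : realType) (disp disp' : measure_display)
    (T : measurableType disp) (T' : measurableType disp')
    (P : probability T R) (I : finType) (X : I -> {RV P >-> T'}) : Prop :=
  forall (J : {set I}) (B : I -> set T'), (forall i, measurable (B i)) ->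
    P (\bigcap_(i in [set` J]) (X i @^-1` B i)) =
    (\prod_(i in J) P (X i @^-1` B i))%E.

Record sgraph (V : finType) := SGraph {
  adj :> rel V;
  adj_sym : symmetric adj;
  adj_irrefl : irreflexive adj }.

Definition colorable (V : finType) (G : sgraph V) (k : nat) : bool :=
  [exists f : {ffun V -> 'I_k}, forall x, forall y, G x y ==> (f x != f y)].

Lemma colorable_card (V : finType) (G : sgraph V) : exists k, colorable G k.
Proof.
exists #|V|; apply/existsP; exists [ffun x => enum_rank x].
apply/forallP => x; apply/forallP => y; apply/implyP => xy.
rewrite !ffunE; apply: contraTneq xy => /enum_rank_inj ->.
by rewrite adj_irrefl.
Qed.

Definition chromatic_number (V : finType) (G : sgraph V) : nat :=
  ex_minn (colorable_card G).

Definition borsuk_rel (R : realType) (m n : nat) (eps : R)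
    (x : 'I_n -> 'rV[R]_m) : rel 'I_n :=
  fun i j => (i != j) && (2 - eps < enorm (x i - x j)).

Lemma borsuk_sym (R : realType) (m n : nat) (eps : R) (x : 'I_n -> 'rV[R]_m) :
  symmetric (borsuk_rel eps x).
Proof.
move=> i j; rewrite /borsuk_rel eq_sym; congr (_ && (_ < Num.sqrt _)).
by apply: eq_bigr => k _; rewrite !mxE -sqrrN opprB.
Qed.

Lemma borsuk_irrefl (R : realType) (m n : nat) (eps : R)
    (x : 'I_n -> 'rV[R]_m) : irreflexive (borsuk_rel eps x).
Proof. by move=> i; rewrite /borsuk_rel eqxx. Qed.

Definition Bor (R : realType) (m n : nat) (eps : R) (x : 'I_n -> 'rV[R]_m) :
    sgraph 'I_n :=
  SGraph (borsuk_sym eps x) (borsuk_irrefl eps x).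

(* [v] lists the d+2 vertices. Equal positive edge lengths make d+2 points of
   R^(d+1) affinely independent, so no non-degeneracy condition is needed. *)
Definition regular_inscribed_simplex (R : realType) (d : nat)
    (v : 'I_d.+2 -> 'rV[R]_d.+1) : Prop :=
  (forall i, @sphere R d (v i)) /\
  exists2 s : R, 0 < s & forall i j, i != j -> enorm (v i - v j) = s.

(* The facet opposite to the vertex [v k]. *)
Definition facet (R : realType) (d : nat) (v : 'I_d.+2 -> 'rV[R]_d.+1)
    (k : 'I_d.+2) : set 'rV[R]_d.+1 :=
  [set x | exists w : 'I_d.+2 -> R,
    [/\ forall i, 0 <= w i, w k = 0, \sum_i w i = 1 & x = \sum_i w i *: v i]].

Definition radial (R : realType) (m : nat) (x : 'rV[R]_m) : 'rV[R]_m :=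
  (enorm x)^-1 *: x.

(* lambda_d, computed from a given regular inscribed simplex and facet. *)
Definition lambda (R : realType) (d : nat) (v : 'I_d.+2 -> 'rV[R]_d.+1)
    (k : 'I_d.+2) : R :=
  ediam (@radial R d.+1 @` facet v k).

(* Main.v *)
Require Import Defs.
From mathcomp Require Import all_boot all_order all_algebra.
From mathcomp Require Import all_classical all_reals all_analysis.
From mathcomp Require Import measurable_realfun.
From mathcomp Require Import ring lra zify.

(* With high probability some spherical cap of squared chordal size of order
   (ln n / n)^(2/d) contains no sample point. Rotating its centre p to the
   diagonal direction and colouring a point by the index of its largest
   coordinate, two points x, y of the same colour outside the cap satisfy
   |x + y|^2 >= s^2 / (d + 1), s being the sine of the angular radius of the cap,
   hence |x - y| <= 2 - s^2 / (4 (d + 1)).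

   The measure of a cap is at most (1/2) (s / sqrt (1 - s^2))^d, because the cap is
   the image of a hemisphere under an (s / sqrt (1 - s^2))-Lipschitz map. This
   bounds the probability of an empty cap from below and also yields, greedily,
   many disjoint caps; the second moment method then produces an empty one.

   The constants match because lambda_d^2 >= 4 - 4 / (d + 2), as witnessed by the
   centres of two complementary faces of the facet of nearly equal size. *)

Set Implicit Arguments.
Unset Strict Implicit.
Unset Printing Implicit Defensive.

Import Order.TTheory GRing.Theory Num.Theory.
Import numFieldNormedType.Exports.

Local Open Scope classical_set_scope.
Local Open Scope ring_scope.

(** * Euclidean geometry and the colouring *)

Section Dot.
Variables (R : realType) (m : nat).
Implicit Types x y z p : 'rV[R]_m.

Definition dot x y : R := \sum_(i < m) x ord0 i * y ord0 i.

Lemma dotC x y : dot x y = dot y x.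
Proof. by apply: eq_bigr => i _; rewrite mulrC. Qed.

Lemma dotDl x y z : dot (x + y) z = dot x z + dot y z.
Proof. by rewrite /dot -big_split; apply: eq_bigr => i _; rewrite mxE mulrDl. Qed.

Lemma dotZl a x y : dot (a *: x) y = a * dot x y.
Proof. by rewrite /dot mulr_sumr; apply: eq_bigr => i _; rewrite mxE mulrA. Qed.

Lemma dotNl x y : dot (- x) y = - dot x y.
Proof. by rewrite -scaleN1r dotZl mulN1r. Qed.

Lemma dotBl x y z : dot (x - y) z = dot x z - dot y z.
Proof. by rewrite dotDl dotNl. Qed.

Lemma dotDr x y z : dot z (x + y) = dot z x + dot z y.
Proof. by rewrite dotC dotDl !(dotC _ z). Qed.

Lemma dotZr a x y : dot y (a *: x) = a * dot y x.
Proof. by rewrite dotC dotZl dotC. Qed.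

Lemma dotNr x y : dot y (- x) = - dot y x.
Proof. by rewrite dotC dotNl dotC. Qed.

Lemma dotBr x y z : dot z (x - y) = dot z x - dot z y.
Proof. by rewrite dotDr dotNr. Qed.

Lemma dot0l x : dot 0 x = 0.
Proof. by rewrite -(scale0r x) dotZl mul0r. Qed.

Lemma dot_sumr (I : finType) (F : I -> 'rV[R]_m) x :
  dot x (\sum_i F i) = \sum_i dot x (F i).
Proof.
elim/big_ind2: _ => [|x1 x2 y1 y2 <- <-|//]; first by rewrite dotC dot0l.
by rewrite dotDr.
Qed.

Lemma dot_ge0 x : 0 <= dot x x.
Proof. by apply: sumr_ge0 => i _; rewrite -expr2 sqr_ge0. Qed.

Lemma dot_eq0 x : (dot x x == 0) = (x == 0).
Proof.
apply/eqP/eqP => [|->]; last by rewrite dot0l.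
move/eqP; rewrite psumr_eq0 => [/allP x0|i _]; last by rewrite -expr2 sqr_ge0.
apply/rowP => i; rewrite mxE; have := x0 i (mem_index_enum i).
by rewrite /= mulf_eq0 orbb => /eqP.
Qed.

Lemma enorm_dot x : enorm x = Num.sqrt (dot x x).
Proof. by congr Num.sqrt; apply: eq_bigr => i _; rewrite expr2. Qed.

Lemma sqr_enorm x : enorm x ^+ 2 = dot x x.
Proof. by rewrite enorm_dot sqr_sqrtr // dot_ge0. Qed.

Lemma enorm_ge0 x : 0 <= enorm x.
Proof. exact: sqrtr_ge0. Qed.

Lemma enorm1_dot x : (enorm x = 1) <-> (dot x x = 1).
Proof.
split=> [x1|x1]; first by rewrite -sqr_enorm x1 expr1n.
by rewrite enorm_dot x1 sqrtr1.
Qed.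

Lemma enorm_le x a : 0 <= a -> (enorm x <= a) = (dot x x <= a ^+ 2).
Proof. by move=> a0; rewrite -sqr_enorm ler_sqr ?nnegrE ?enorm_ge0. Qed.

Lemma dot_cauchy x y : dot x y ^+ 2 <= dot x x * dot y y.
Proof.
have [y0|y0] := eqVneq (dot y y) 0.
  have /eqP := y0; rewrite dot_eq0 => /eqP ->.
  by rewrite dotC dot0l expr0n /= dot0l mulr0.
have yp : 0 < dot y y by rewrite lt_neqAle eq_sym y0 dot_ge0.
have := dot_ge0 (dot y y *: x - dot x y *: y).
rewrite !(dotBl, dotBr, dotZl, dotZr) (dotC y x) => h.
rewrite -subr_ge0 -(pmulr_rge0 _ yp); apply: le_trans h _.
rewrite le_eqVlt; apply/orP; left; apply/eqP; ring.
Qed.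

Definition perp p x := x - dot x p *: p.

Lemma dot_perp p x y : dot p p = 1 ->
  dot (perp p x) (perp p y) = dot x y - dot x p * dot y p.
Proof.
by move=> p1; rewrite !(dotBl, dotBr, dotZl, dotZr) p1 (dotC p y); ring.
Qed.

Lemma dot_perpp p x : dot p p = 1 -> dot (perp p x) p = 0.
Proof. by move=> p1; rewrite !(dotBl, dotZl) p1 mulr1 subrr. Qed.

Lemma perpD p x y : perp p (x + y) = perp p x + perp p y.
Proof. by rewrite /perp dotDl scalerDl opprD addrACA. Qed.

Lemma perpB p x y : perp p (x - y) = perp p x - perp p y.
Proof. by apply/rowP => i; rewrite !mxE dotBl; ring. Qed.

(* The reflection exchanging the unit vectors p and q. It is the identity if
   p = q, since 0 / 0 = 0. *)
Definition swap_refl p q x :=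
  x - (2 * dot x (p - q) / dot (p - q) (p - q)) *: (p - q).

Lemma dot_swap_refl p q x y : dot (swap_refl p q x) (swap_refl p q y) = dot x y.
Proof.
rewrite /swap_refl; move: (p - q) => w.
have [w0|w0] := eqVneq (dot w w) 0; first by rewrite w0 invr0 !mulr0 !scale0r !subr0.
rewrite !(dotBl, dotBr, dotZl, dotZr) (dotC w y).
by field.
Qed.

Lemma swap_reflD p q x y :
  swap_refl p q (x + y) = swap_refl p q x + swap_refl p q y.
Proof.
by rewrite /swap_refl dotDl mulrDr mulrDl scalerDl opprD addrACA.
Qed.

Lemma swap_reflE p q : dot p p = 1 -> dot q q = 1 -> swap_refl p q p = q.
Proof.
move=> p1 q1; rewrite /swap_refl.
have [/eqP w0|w0] := eqVneq (dot (p - q) (p - q)) 0.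
  rewrite dot_eq0 subr_eq0 in w0; rewrite (eqP w0) subrr scaler0 subr0 //.
have e : dot (p - q) (p - q) = 2 * dot p (p - q).
  by rewrite !(dotBl, dotBr) p1 q1 (dotC q p); ring.
by rewrite -e divff // scale1r opprB addrC subrK.
Qed.

Lemma dot_swap_refl_target p q x : dot p p = 1 -> dot q q = 1 ->
  dot (swap_refl p q x) q = dot x p.
Proof. by move=> p1 q1; rewrite -[RHS](dot_swap_refl p q) swap_reflE. Qed.

End Dot.

Section Colour.
Variables (R : realType) (d : nat).
Implicit Types x y p : 'rV[R]_d.+1.

(* With z = y + y', a coordinate y_j < 0 satisfies |y_j| <= |z_j| + y'_i, while
   y'_i is itself controlled by z_i = y_i + y'_i. *)
Lemma same_argmax_dot (i : 'I_d.+1) y y' :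
  0 <= y ord0 i -> 0 <= y' ord0 i ->
  (forall j, y ord0 j <= y ord0 i) -> (forall j, y' ord0 j <= y' ord0 i) ->
  dot y y <= d.+1%:R * dot (y + y') (y + y').
Proof.
move=> M0 M'0 ym y'm.
set M := y ord0 i in M0 ym *; set M' := y' ord0 i in M'0 y'm *.
(* The two constant terms are summed over the d indices other than i. Adding the term d M^2 of index
   i gives d (d + 1) (M^2 + M'^2), which [zi] absorbs. *)
have key j : d%:R * y ord0 j ^+ 2 <=
    d.+1%:R * d%:R * (y + y') ord0 j ^+ 2 + (d%:R * M ^+ 2 + d.+1%:R * M' ^+ 2).
  have d0 : (0 : R) <= d%:R by [].
  have d1 : (0 : R) <= d.+1%:R by [].
  have := ym j; have := y'm j; rewrite mxE.
  move: (y ord0 j) (y' ord0 j) => a a' a'M aM.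
  have p1 : 0 <= d.+1%:R * d%:R * (a + a') ^+ 2.
    by apply: mulr_ge0; [exact: mulr_ge0 | exact: sqr_ge0].
  have p2 : 0 <= d.+1%:R * M' ^+ 2 by apply: mulr_ge0 => //; exact: sqr_ge0.
  have p3 : 0 <= d%:R * M ^+ 2 by apply: mulr_ge0 => //; exact: sqr_ge0.
  have [a0|a0] := leP 0 a.
    have : d%:R * a ^+ 2 <= d%:R * M ^+ 2 by rewrite ler_wpM2l // ler_sqr.
    lra.
  rewrite -natr1 in p1 p2 d1 *.
  have [b0|b0] := leP 0 (a + M').
    have : d%:R * a ^+ 2 <= d%:R * M' ^+ 2.
      by rewrite ler_wpM2l // -sqrrN ler_sqr ?nnegrE; lra.
    have := sqr_ge0 M'; lra.
  set b := - (a + M').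
  have bb : b ^+ 2 <= (a + a') ^+ 2.
    by rewrite -(sqrrN (a + a')) ler_sqr ?nnegrE /b; lra.
  have -> : a ^+ 2 = (b + M') ^+ 2 by rewrite /b; ring.
  (* This square is d (d + 1) b^2 + (d + 1) M'^2 - d (b + M')^2. *)
  have : 0 <= (d%:R * b - M') ^+ 2 by exact: sqr_ge0.
  have : (d%:R + 1) * d%:R * b ^+ 2 <= (d%:R + 1) * d%:R * (a + a') ^+ 2.
    by apply: ler_wpM2l => //; apply: mulr_ge0.
  lra.
have zi : M ^+ 2 + M' ^+ 2 <= (y + y') ord0 i ^+ 2.
  rewrite mxE -/M -/M' sqrrD; have := mulr_ge0 M0 M'0; lra.
(* [key] carries a factor d that has to be cancelled, so a single coordinate is treated apart. *)
have [d0|dn0] := eqVneq d 0%N.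
  have E0 (z : 'rV[R]_d.+1) : dot z z = z ord0 i ^+ 2.
    rewrite /dot (bigD1 i) //= big1 ?addr0 ?expr2 // => j /negP[].
    have le0 (k : 'I_d.+1) : val k = 0%N.
      by have := ltn_ord k; rewrite ltnS {2}d0 leqn0 => /eqP.
    by apply/eqP/val_inj; rewrite !le0.
  rewrite !E0 -/M; apply: (@le_trans _ _ ((y + y') ord0 i ^+ 2)).
    have := sqr_ge0 M'; lra.
  by rewrite ler_peMl ?sqr_ge0 // ler1n.
have dp : (0 : R) < d%:R by rewrite ltr0n lt0n.
rewrite -(ler_pM2l dp) /dot (bigD1 i) //= [in leRHS](bigD1 i) //=.
rewrite -/M -!expr2 mulrDr.
have : d%:R * \sum_(j < d.+1 | j != i) y ord0 j * y ord0 j <=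
   d.+1%:R * d%:R * (\sum_(j < d.+1 | j != i) (y + y') ord0 j * (y + y') ord0 j)
   + d%:R * (d%:R * M ^+ 2 + d.+1%:R * M' ^+ 2).
  rewrite !mulr_sumr.
  have -> : d%:R * (d%:R * M ^+ 2 + d.+1%:R * M' ^+ 2) =
     \sum_(j < d.+1 | j != i) (d%:R * M ^+ 2 + d.+1%:R * M' ^+ 2).
    by rewrite sumr_const cardC1 card_ord mulr_natl.
  rewrite -big_split; apply: ler_sum => j _; rewrite -!expr2; exact: key.
set S1 := \sum_(_ < _ | _) _; set S2 := \sum_(_ < _ | _) _ => h.
apply: (@le_trans _ _ (d%:R * M ^+ 2 + (d.+1%:R * d%:R * S2 +
   d%:R * (d%:R * M ^+ 2 + d.+1%:R * M' ^+ 2)))); first by rewrite lerD2l.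
have : d.+1%:R * d%:R * (M ^+ 2 + M' ^+ 2) <= d.+1%:R * d%:R * (y + y') ord0 i ^+ 2.
  by rewrite ler_wpM2l // mulr_ge0.
by rewrite -natr1; lra.
Qed.

Definition diag : 'rV[R]_d.+1 := const_mx (Num.sqrt d.+1%:R)^-1.

Lemma dot_diag : dot diag diag = 1.
Proof.
rewrite /dot (eq_bigr (fun=> d.+1%:R^-1)) => [|i _].
  by rewrite sumr_const card_ord -[LHS]mulr_natl divff // pnatr_eq0.
by rewrite !mxE -invfM -expr2 sqr_sqrtr.
Qed.

Definition colour p x : 'I_d.+1 :=
  [arg max_(j > ord0) swap_refl p diag x ord0 j]%O.

(** Projecting along the diagonal subtracts the same number from all coordinates, so the argmax
    survives. The new coordinates sum to 0, so the largest is nonnegative. *)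
Lemma perp_diag_max (u : 'rV[R]_d.+1) (i : 'I_d.+1) : (forall j, u ord0 j <= u ord0 i) ->
  (forall j, perp diag u ord0 j <= perp diag u ord0 i) /\
  0 <= perp diag u ord0 i.
Proof.
move=> umax.
have ymax j : perp diag u ord0 j <= perp diag u ord0 i.
  by rewrite !mxE lerD2r.
split=> //; rewrite leNgt; apply/negP => y0.
have /eqP := dot_perpp u dot_diag; rewrite lt_eqF // /dot.
rewrite -oppr_gt0 -sumrN (bigD1 i) //= ltr_wpDr //.
  apply: sumr_ge0 => j _; rewrite oppr_ge0 mulr_le0_ge0 //.
    exact: le_trans (ymax j) (ltW y0).
  by rewrite mxE invr_ge0 sqrtr_ge0.
by rewrite oppr_gt0 nmulr_rlt0 // mxE invr_gt0 sqrtr_gt0.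
Qed.

(** [same_argmax_dot] is applied to the projections orthogonal to the diagonal. With t >= t' the
    heights of x and y over p, it yields 1 - t^2 <= (d + 1) (|x + y|^2 - (t + t')^2). *)
Lemma same_colour_dist p h x y : dot p p = 1 -> 0 < h -> h <= 1 ->
  dot x x = 1 -> dot y y = 1 -> dot x p <= h -> dot y p <= h ->
  colour p x = colour p y ->
  enorm (x - y) <= 2 - (1 - h ^+ 2) / (4 * d.+1%:R).
Proof.
move=> p1 h0 h1 x1 y1; wlog xy : x y x1 y1 / dot y p <= dot x p => [hw xh yh c|].
  have [xy|xy] := leP (dot y p) (dot x p); first exact: hw.
  suff -> : enorm (x - y) = enorm (y - x) by apply: hw => //; exact: ltW.
  by rewrite !enorm_dot -opprB dotNl dotNr opprK.
move=> xh yh; rewrite /colour.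
case: arg_maxP => // i _ xmax; case: arg_maxP => // j _ ymax ij.
rewrite -{j}ij in ymax.
have [{}xmax x0] := perp_diag_max (fun j => xmax j isT).
have [{}ymax y0] := perp_diag_max (fun j => ymax j isT).
have := same_argmax_dot x0 y0 xmax ymax.
rewrite -perpD -swap_reflD !(dot_perp _ _ dot_diag).
rewrite !dot_swap_refl x1 !dot_swap_refl_target ?dot_diag //.
rewrite (dotDl x y p) => hD.
have D0 : 0 < d.+1%:R :> R by rewrite ltr0n.
have hK : (1 - h ^+ 2) / d.+1%:R <= dot (x + y) (x + y).
  rewrite ler_pdivrMr // [_ * d.+1%:R]mulrC.
  (* If t >= 0 then t^2 <= h^2. If t < 0 then t' <= t < 0, and (t + t')^2 >= t^2 makes up for the
     loss of t^2. *)
  have [t0|t0] := leP 0 (dot x p).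
    have : dot x p ^+ 2 <= h ^+ 2 by rewrite ler_sqr ?nnegrE // ltW.
    have : 0 <= d.+1%:R * (dot x p + dot y p) ^+ 2.
      by apply: mulr_ge0; [exact: ltW | exact: sqr_ge0].
    by lra.
  have D1 : 1 <= d.+1%:R :> R by rewrite ler1n.
  have s : dot x p ^+ 2 <= (dot x p + dot y p) ^+ 2.
    by rewrite -sqrrN -(sqrrN (_ + _)) ler_sqr ?nnegrE; lra.
  have : dot x p ^+ 2 <= d.+1%:R * (dot x p + dot y p) ^+ 2.
    by apply: le_trans s _; rewrite ler_peMl ?sqr_ge0.
  have := sqr_ge0 h; lra.
have -> : (1 - h ^+ 2) / (4 * d.+1%:R) = (1 - h ^+ 2) / d.+1%:R / 4.
  by rewrite invfM [4^-1 * _]mulrC mulrA.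
have K1 : (1 - h ^+ 2) / d.+1%:R <= 1.
  by rewrite ler_pdivrMr // mul1r (@le_trans _ _ 1) ?ler1n // gerBl sqr_ge0.
move: hK K1; set K := _ / _ => hK K1.
rewrite enorm_le; last by lra.
have -> : dot (x - y) (x - y) = 4 - dot (x + y) (x + y).
  by rewrite !(dotBl, dotBr, dotDl, dotDr) x1 y1 (dotC y x); ring.
(* (2 - K / 4)^2 = 4 - K + K^2 / 16. *)
have := sqr_ge0 K; lra.
Qed.

End Colour.

(** * Hausdorff measure of caps *)

Section Hausdorff.
Variables (R : realType) (m d : nat).
Implicit Types (A : set 'rV[R]_m) (f : 'rV[R]_m -> 'rV[R]_m).

Lemma ediam_ge0 A : 0 <= ediam A.
Proof.
rewrite /ediam; set S := [set _ | _ in _].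
have [[S0 Sb]|nS] := pselect (has_sup S); last by rewrite sup_out.
case: (S0) => _ [[x y] xy _].
by apply: le_trans (enorm_ge0 (x - y)) _; apply: ub_le_sup => //; exists (x, y).
Qed.

(** The bound [delta] keeps [ediam B] from being the default value 0 of an unbounded supremum. *)
Lemma ediam_lipschitz f L delta A B : 0 <= L ->
  (forall x y, A x -> A y -> enorm (f x - f y) <= L * enorm (x - y)) ->
  (forall x y, B x -> B y -> enorm (x - y) <= delta) ->
  ediam (f @` (A `&` B)) <= L * ediam B.
Proof.
move=> L0 fL Bd.
have [->|/set0P[z [Az Bz]]] := eqVneq (A `&` B) set0.
  by rewrite image_set0 {1}/ediam set0X image_set0 sup0 mulr_ge0 // ediam_ge0.
apply: ge_sup.
  by exists (enorm (f z - f z)), (f z, f z) => //; split; exists z.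
move=> _ [[_ _] [/= [x [Ax Bx] <-] [y [Ay By] <-]] <-] /=.
apply: le_trans (fL _ _ Ax Ay) _; rewrite ler_wpM2l //.
apply: ub_le_sup; last by exists (x, y).
by exists delta => _ [[x' y'] [/= Bx' By'] <-]; exact: Bd.
Qed.

(** A cover U of A at scale delta / L is carried to the cover f(A [&] U k) of the image at scale
    delta. Each piece is cut down to A, where the Lipschitz bound holds. *)
Lemma hausdorff_lipschitz f L A : 0 < L -> (0 < d)%N ->
  (forall x y, A x -> A y -> enorm (f x - f y) <= L * enorm (x - y)) ->
  (hausdorff d (f @` A) <= (L ^+ d)%:E * hausdorff d A)%E.
Proof.
move=> L0 d0 fL; have Ld0 : 0 < L ^+ d by rewrite exprn_gt0.
apply: ge_ereal_sup => _ [delta /= delta0 <-].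
rewrite -lee_pdivrMl //; apply: le_trans (ereal_sup_ubound _); last first.
  by exists (delta / L) => //=; rewrite divr_gt0.
apply: le_ereal_inf_tmp => _ [U [AU Ud] <-].
rewrite lee_pdivrMl // -nneseriesZl; last first.
  by move=> i _; rewrite lee_fin exprn_ge0 // ediam_ge0.
apply: (@le_trans _ _ (\sum_(0 <= k <oo) (ediam (f @` (A `&` U k)) ^+ d)%:E)%E).
  apply: ereal_inf_lbound; exists (fun k => f @` (A `&` U k)) => //; split.
    move=> _ [x Ax <-]; have [k _ Ukx] := AU x Ax.
    by exists k => //; exists x.
  move=> k _ _ [x [Ax Ux] <-] [y [Ay Uy] <-].
  apply: le_trans (fL _ _ Ax Ay) _.
  by rewrite -ler_pdivlMl // mulrC; exact: Ud Ux Uy.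
apply: lee_nneseries => [i _ _|i _].
  by rewrite lee_fin exprn_ge0 // ediam_ge0.
rewrite -EFinM lee_fin -exprMn lerXn2r ?nnegrE ?ediam_ge0 //.
  by rewrite mulr_ge0 ?ediam_ge0 // ltW.
exact: ediam_lipschitz (ltW L0) fL (Ud i).
Qed.

Lemma le_hausdorff A B : A `<=` B -> (hausdorff d A <= hausdorff d B)%E.
Proof.
move=> AB; apply: ge_ereal_sup => _ [delta /= delta0 <-].
apply: le_trans (ereal_sup_ubound _); last by exists delta.
apply: ereal_inf_le_tmp => _ [U [BU Ud] <-]; exists U => //; split=> //.
exact: subset_trans BU.
Qed.

Lemma hausdorff_ge0 A : (0 < d)%N -> (0 <= hausdorff d A)%E.
Proof.
move=> d0; apply: le_trans (ereal_sup_ubound _); last by exists 1 => /=.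
apply: le_ereal_inf_tmp => _ [U _ <-]; apply: nneseries_ge0 => k _ _.
by rewrite lee_fin exprn_ge0 // ediam_ge0.
Qed.

End Hausdorff.

Section Cap.
Variables (R : realType) (m : nat).
Implicit Types (p x y : 'rV[R]_m).

(** An open half-space; the intersection with the sphere is taken separately, by [uniform_law] for
    instance. *)
Definition cap p (h : R) : set 'rV[R]_m := [set x | h < dot x p].

(* Shrinks the orthogonal projection onto the hyperplane of p by the factor
   sqrt (1 - h^2), then lifts it back to the hemisphere of p. *)
Definition shrink p (h : R) x :=
  Num.sqrt (1 - h ^+ 2) *: perp p x +
  Num.sqrt (1 - (1 - h ^+ 2) * dot (perp p x) (perp p x)) *: p.

(** Put s^2 = 1 - h^2 and let X, Y be the projections. The horizontal parts differ by s |X - Y|. The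
    new heights a, b are at least h, so |a - b| = s^2 ||X|^2 - |Y|^2| / (a + b) <= s^2 |X - Y| / h.
    Finally s^2 + s^4 / h^2 = s^2 / h^2. *)
Lemma shrink_lipschitz p h x y : dot p p = 1 -> 0 < h -> h < 1 ->
  dot x x = 1 -> dot y y = 1 ->
  enorm (shrink p h x - shrink p h y) <=
  Num.sqrt (1 - h ^+ 2) / h * enorm (x - y).
Proof.
move=> p1 h0 h1 x1 y1.
have s0 : 0 < 1 - h ^+ 2 by rewrite subr_gt0 expr_lt1 // ltW.
rewrite enorm_le; last by rewrite mulr_ge0 ?enorm_ge0 // divr_ge0 ?sqrtr_ge0 // ltW.
rewrite !exprMn sqr_enorm exprVn sqr_sqrtr ?(ltW s0) // /shrink.
set X := perp p x; set Y := perp p y.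
set s := Num.sqrt (1 - h ^+ 2).
have ss : s ^+ 2 = 1 - h ^+ 2 by rewrite sqr_sqrtr // ltW.
have X1 : dot X X <= 1 by rewrite dot_perp // x1 gerBl -expr2 sqr_ge0.
have Y1 : dot Y Y <= 1 by rewrite dot_perp // y1 gerBl -expr2 sqr_ge0.
have Xp : dot X p = 0 by exact: dot_perpp.
have Yp : dot Y p = 0 by exact: dot_perpp.
have XY : dot (X - Y) (X - Y) <= dot (x - y) (x - y).
  by rewrite -perpB dot_perp // gerBl -expr2 sqr_ge0.
clearbody X Y.
have g2 (z : R) : 0 <= z -> z <= 1 ->
   h <= Num.sqrt (1 - (1 - h ^+ 2) * z) /\
   Num.sqrt (1 - (1 - h ^+ 2) * z) ^+ 2 = 1 - (1 - h ^+ 2) * z.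
  move=> z0 z1; have : h ^+ 2 <= 1 - (1 - h ^+ 2) * z by nra.
  move=> hz; rewrite sqr_sqrtr ?(le_trans _ hz) ?sqr_ge0 //; split=> //.
  by rewrite -{1}(ger0_norm (ltW h0)) -sqrtr_sqr ler_wsqrtr.
have [gX gX2] := g2 _ (dot_ge0 X) X1.
have [gY gY2] := g2 _ (dot_ge0 Y) Y1.
move: gX gX2 gY gY2; set a := Num.sqrt _; set b := Num.sqrt _ => ha ha2 hb hb2.
have -> : s *: X + a *: p - (s *: Y + b *: p) = s *: (X - Y) + (a - b) *: p.
  by apply/rowP => i; rewrite !mxE; ring.
have -> : dot (s *: (X - Y) + (a - b) *: p) (s *: (X - Y) + (a - b) *: p) =
    s ^+ 2 * dot (X - Y) (X - Y) + (a - b) ^+ 2.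
  have : dot (X - Y) p = 0 by rewrite dotBl Xp Yp subrr.
  move: (X - Y) => W Wp.
  by rewrite !(dotDl, dotDr, dotZl, dotZr) (dotC p) Wp p1; ring.
rewrite ss.
(* Cauchy-Schwarz for X - Y and X + Y; the 4 bounds |X + Y|^2, as X and Y lie in the unit ball. *)
have CS : (dot X X - dot Y Y) ^+ 2 <= 4 * dot (X - Y) (X - Y).
  have -> : dot X X - dot Y Y = dot (X - Y) (X + Y).
    by rewrite !(dotDl, dotDr, dotNl) (dotC Y X); ring.
  apply: le_trans (dot_cauchy _ _) _; rewrite mulrC ler_wpM2r ?dot_ge0 //.
  have := dot_ge0 (X - Y); rewrite !(dotDr, dotDl, dotNl, dotNr) (dotC Y X); lra.
have ab : (a - b) ^+ 2 * (4 * h ^+ 2) <=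
    (1 - h ^+ 2) ^+ 2 * (4 * dot (X - Y) (X - Y)).
  apply: (@le_trans _ _ ((a - b) ^+ 2 * (a + b) ^+ 2)).
    rewrite ler_wpM2l ?sqr_ge0 //.
    have -> : 4 * h ^+ 2 = (h + h) ^+ 2 by ring.
    by rewrite ler_sqr ?nnegrE; lra.
  rewrite -exprMn -subr_sqr ha2 hb2.
  have -> : 1 - (1 - h ^+ 2) * dot X X - (1 - (1 - h ^+ 2) * dot Y Y) =
     - (1 - h ^+ 2) * (dot X X - dot Y Y) by ring.
  by rewrite exprMn sqrrN ler_wpM2l ?sqr_ge0.
rewrite -[leRHS]mulrA [_^-1 * _]mulrC mulrA ler_pdivlMr ?exprn_gt0 //.
have : (1 - h ^+ 2) * dot (X - Y) (X - Y) <= (1 - h ^+ 2) * dot (x - y) (x - y).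
  by rewrite ler_wpM2l // ltW.
lra.
Qed.

Lemma shrink_onto p h : dot p p = 1 -> 0 < h -> h < 1 ->
  cap p h `&` [set x | dot x x = 1] `<=`
  shrink p h @` (cap p 0 `&` [set x | dot x x = 1]).
Proof.
move=> p1 h0 h1 z [/= hz z1].
have s0 : 0 < 1 - h ^+ 2 by rewrite subr_gt0 expr_lt1 // ltW.
set s := Num.sqrt (1 - h ^+ 2).
have sp : 0 < s by rewrite sqrtr_gt0.
have sn0 : s != 0 by rewrite gt_eqF.
have ss : s ^+ 2 = 1 - h ^+ 2 by rewrite sqr_sqrtr // ltW.
set t := dot z p in hz.
have Z : dot (perp p z) (perp p z) = 1 - t ^+ 2 by rewrite dot_perp // z1 -expr2.
have zp : dot (perp p z) p = 0 by exact: dot_perpp.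
have zE : z = perp p z + t *: p by rewrite subrK.
move: (perp p z) Z zp zE => w Z zp zE.
have ht : h ^+ 2 < t ^+ 2 by rewrite ltr_sqr ?nnegrE // ltW // (lt_trans h0).
(* The squared height that puts the preimage on the sphere once the horizontal part w is divided by
   s; it is positive because t > h. *)
set c := 1 - (1 - t ^+ 2) / s ^+ 2.
have c0 : 0 < c.
  by rewrite subr_gt0 ltr_pdivrMr ?exprn_gt0 // mul1r ss; lra.
set x := s^-1 *: w + Num.sqrt c *: p.
have xp : dot x p = Num.sqrt c by rewrite !(dotDl, dotZl) zp p1; ring.
have xx : dot x x = 1.
  rewrite !(dotDl, dotZl, dotDr, dotZr) (dotC p) zp p1 Z.
  rewrite !mulr0 addr0 add0r mulr1 -expr2 sqr_sqrtr ?ltW // /c.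
  by field.
exists x; first by split=> //=; rewrite /cap /= xp sqrtr_gt0.
rewrite /shrink -/s.
have -> : perp p x = s^-1 *: w by rewrite {1}/perp xp /x addrK.
rewrite dotZl dotZr Z scalerA divff // scale1r.
have -> : 1 - (1 - h ^+ 2) * (s^-1 * (s^-1 * (1 - t ^+ 2))) = t ^+ 2.
  by rewrite -ss; field.
by rewrite sqrtr_sqr ger0_norm ?zE // ltW // (lt_trans h0).
Qed.

End Cap.

Section CapLaw.
Variables (R : realType) (d : nat).
Implicit Types (p x y : 'rV[R]_d.+1).

(** Both sides carry the same normalising factor, so the measure of the sphere need not be known. *)
Lemma cap_law_lipschitz p h : (0 < d)%N -> dot p p = 1 -> 0 < h -> h < 1 ->
  (uniform_law (cap p h) <=
   ((Num.sqrt (1 - h ^+ 2) / h) ^+ d)%:E * uniform_law (cap p 0))%E.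
Proof.
move=> d0 p1 h0 h1; rewrite /uniform_law muleA lee_wpmul2r //.
  by rewrite inve_ge0 hausdorff_ge0.
have SE : @sphere R d = [set x | dot x x = 1].
  by apply/seteqP; split=> x /enorm1_dot.
apply: le_trans (hausdorff_lipschitz _ _ _) => //; last first.
- move=> x y [_ Sx] [_ Sy]; apply: shrink_lipschitz p1 h0 h1 _ _; exact/enorm1_dot.
- by rewrite divr_gt0 // sqrtr_gt0 subr_gt0 expr_lt1 // ltW.
- by apply: le_hausdorff; rewrite SE; exact: shrink_onto.
Qed.

(** The antipodal map is 1-Lipschitz. Since opposite open hemispheres are disjoint, this bounds each
    of them by 1/2 in [cap_prob]. *)
Lemma hemisphere_law_opp p : (0 < d)%N ->
  (uniform_law (cap p 0) <= uniform_law (cap (- p) 0))%E.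
Proof.
move=> d0; rewrite /uniform_law lee_wpmul2r ?inve_ge0 ?hausdorff_ge0 //.
rewrite -[leRHS]mul1e -(expr1n R d).
apply: le_trans (@hausdorff_lipschitz R _ d -%R 1 _ ltr01 d0 _) => [|x y _ _].
  apply: le_hausdorff => x [hx Sx]; exists (- x); last by rewrite opprK.
  split; first by rewrite /cap /= dotNl dotNr opprK.
  by apply/enorm1_dot; rewrite dotNl dotNr opprK; apply/enorm1_dot.
by rewrite mul1r !enorm_dot -opprD dotNl dotNr opprK.
Qed.

End CapLaw.

(** * Second moment method *)

Section SecondMoment.
Context {R : realType} {disp : measure_display} {T : measurableType disp}.
Variable P : probability T R.

Lemma integral_sum_indic (I : finType) (c : I -> R) (B : I -> set T) :
  (forall i, 0 <= c i) -> (forall i, measurable (B i)) ->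
  (\int[P]_t (\sum_i c i * \1_(B i) t)%:E = \sum_i (c i)%:E * P (B i))%E.
Proof.
move=> c0 mB.
under eq_integral do rewrite -sumEFin.
rewrite ge0_integral_sum //=; last 2 first.
- by move=> i; apply/measurable_EFinP; apply: measurable_funM.
- by move=> i t _; rewrite lee_fin mulr_ge0.
apply: eq_bigr => i _.
under eq_integral do rewrite EFinM.
rewrite ge0_integralZl_EFin ?integral_indic ?setIT //.
by apply/measurable_EFinP; exact: measurable_indic.
Qed.

(** Integrates a pointwise inequality. Coefficients are nonnegative on both sides, so negative terms
    have to be moved across first. *)
Lemma sum_indic_le (I J : finType) (c : I -> R) (e : J -> R)
    (B : I -> set T) (F : J -> set T) :
  (forall i, 0 <= c i) -> (forall j, 0 <= e j) ->
  (forall i, measurable (B i)) -> (forall j, measurable (F j)) ->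
  (forall t, \sum_i c i * \1_(B i) t <= \sum_j e j * \1_(F j) t) ->
  (\sum_i (c i)%:E * P (B i) <= \sum_j (e j)%:E * P (F j))%E.
Proof.
move=> c0 e0 mB mF BF; rewrite -!integral_sum_indic //.
apply: ge0_le_integral => //.
- by move=> t _; rewrite lee_fin sumr_ge0 // => i _; rewrite mulr_ge0.
- apply/measurable_EFinP; apply: measurable_sum => i.
  by apply: measurable_funM.
- apply/measurable_EFinP; apply: measurable_sum => i.
  by apply: measurable_funM.
- by move=> t _; rewrite lee_fin BF.
Qed.

(* Integrating 1_(no E k) <= (1 - Z / m)^2 with Z = sum_k 1_(E k) and m = E[Z]. *)
Lemma second_moment (N : nat) (E : 'I_N -> set T) (q : 'I_N -> R) :
  (forall k, measurable (E k)) -> (forall k, P (E k) = (q k)%:E) ->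
  (forall k l, k != l -> (P (E k `&` E l) <= (q k * q l)%:E)%E) ->
  0 < \sum_k q k ->
  (P (~` \bigcup_k E k) <= ((\sum_k q k)^-1)%:E)%E.
Proof.
move=> mE qE qEE; set m := \sum_k q k => m0.
have mU : measurable (~` \bigcup_k E k).
  by apply: measurableC; apply: fin_bigcup_measurable => // k _; exact: mE.
have q0 k : 0 <= q k by rewrite -lee_fin -qE.
(* The inequality 1_(no E k) <= (1 - Z / m)^2 rearranged as 1_(no E k) + (2 / m) Z <= 1 + Z^2 / m^2.
   The [inl] indices stand for the complement event and for the constant 1. *)
pose c (i : 'I_1 + 'I_N) : R := if i is inl _ then 1 else 2 / m.
pose B (i : 'I_1 + 'I_N) := if i is inr k then E k else ~` \bigcup_k E k.
pose e (j : 'I_1 + 'I_N * 'I_N) : R := if j is inl _ then 1 else m ^- 2.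
pose F (j : 'I_1 + 'I_N * 'I_N) :=
  if j is inr kl then E kl.1 `&` E kl.2 else setT.
have m2 : 0 <= m ^- 2 by rewrite invr_ge0 sqr_ge0.
have := @sum_indic_le _ _ c e B F.
rewrite !big_sumType !big_ord1 /= !mul1e probability_setT => /(_ _)/wrap[].
  by case=> //= _; rewrite divr_ge0 // ltW.
move=> /(_ _)/wrap[]; first by case.
move=> /(_ _)/wrap[]; first by case.
move=> /(_ _)/wrap[]; first by case=> [?|kl] /=; [exact: measurableT |
  exact: measurableI].
move=> /(_ _)/wrap[].
  move=> t; rewrite !big_sumType !big_ord1 /= indicT !mul1r.
  rewrite -mulr_sumr -mulr_sumr.
  have -> : \sum_(kl : 'I_N * 'I_N) \1_(E kl.1 `&` E kl.2) t =
      (\sum_k \1_(E k) t) ^+ 2 :> R.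
    rewrite expr2 big_distrlr /= pair_big /=; apply: eq_bigr => kl _.
    by rewrite indicI.
  have [tE|tE] := pselect ((\bigcup_k E k) t).
    rewrite indicE memNset; last by move=> /(_ tE).
    set Z := \sum_k _; rewrite add0r -subr_ge0.
    have -> : 1 + m ^- 2 * Z ^+ 2 - 2 / m * Z = (1 - Z / m) ^+ 2.
      by field; rewrite gt_eqF.
    exact: sqr_ge0.
  rewrite big1; last first.
    by move=> k _; rewrite indicE memNset // => Ekt; apply: tE; exists k.
  by rewrite expr0n !mulr0 !addr0 indicE; case: (_ \in _).
under eq_bigr do rewrite qE -EFinM.
rewrite sumEFin -mulr_sumr -/m divfK ?gt_eqF // => h.
have {}h : (P (~` \bigcup_k E k) + 2%:E <= 1 + (m ^- 2 * (m + m ^+ 2))%:E)%E.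
  apply: le_trans h _; rewrite leeD2l // -ge0_sume_distrr // EFinM.
  rewrite lee_wpmul2l //.
  (* E[Z^2] <= m + m^2: a diagonal pair has probability q k, the others at most q k * q l. *)
  apply: (@le_trans _ _ (\sum_k \sum_l ((if l == k then q k else 0) + q k * q l)%:E)%E).
    rewrite pair_big /=; apply: lee_sum => -[k l] _ /=.
    have [->|lk] := eqVneq l k; last by rewrite add0r qEE // eq_sym.
    by rewrite setIid qE lee_fin lerDl mulr_ge0.
  under eq_bigr do rewrite sumEFin.
  rewrite sumEFin lee_fin.
  under eq_bigr do rewrite big_split /= -mulr_sumr -big_mkcond /= big_pred1_eq.
  by rewrite big_split /= -mulr_suml -/m expr2.
have : measurable (~` \bigcup_k E k) by [].
move=> /(fin_num_measure P) /fineK Pe; rewrite -Pe in h *.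
rewrite -!EFinD !lee_fin in h *.
have e1 : m ^- 2 * (m + m ^+ 2) = m^-1 + 1 by field; rewrite gt_eqF.
by rewrite e1 in h; lra.
Qed.

End SecondMoment.

(** * Empty caps *)

Section Measurability.
Variables (R : realType) (m : nat).

Lemma measurable_coord (i : 'I_m) :
  measurable_fun [set: borelE R m] (fun x : borelE R m => (x : 'rV[R]_m) ord0 i).
Proof.
apply: (measurability _ (RGenOpens.measurableE R)) => _ [_ [a [b ->]] <-].
rewrite setTI; apply: sub_sigma_algebra.
apply: open_comp; last exact: interval_open.
by move=> x _; exact: coord_continuous.
Qed.

Lemma measurable_dot (disp : measure_display) (T : measurableType disp)
    (f g : T -> borelE R m) :
  measurable_fun [set: T] f -> measurable_fun [set: T] g ->
  measurable_fun [set: T] (fun t => dot (f t) (g t)).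
Proof.
move=> mf mg; apply: measurable_sum => i; apply: measurable_funM.
- exact: measurableT_comp (measurable_coord i) mf.
- exact: measurableT_comp (measurable_coord i) mg.
Qed.

Lemma measurable_cap (p : 'rV[R]_m) h :
  measurable (cap p h : set (borelE R m)).
Proof.
have := measurable_dot (@measurable_id _ (borelE R m) setT)
  (@measurable_cst _ _ (borelE R m) (borelE R m) setT p).
move=> /(_ measurableT `]h, +oo[%classic (measurable_itv _)).
rewrite setTI; congr measurable.
by apply/seteqP; split => x /=; rewrite /cap /= in_itv /= andbT.
Qed.

Lemma measurable_dist (disp : measure_display) (T : measurableType disp)
    (f g : T -> borelE R m) a :
  measurable_fun [set: T] f -> measurable_fun [set: T] g -> 
  measurable [set t | enorm ((f t : 'rV[R]_m) - g t) <= a].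
Proof.
move=> mf mg.
have [a0|a0] := ltP a 0.
  rewrite (_ : [set _ | _] = set0) //; apply/seteqP; split=> // t /=.
  by move=> /(le_trans (enorm_ge0 _)); rewrite leNgt a0.
have md : measurable_fun [set: T] (fun t => dot ((f t : 'rV[R]_m) - g t) (f t - g t)).
  apply: measurable_sum => i.
  have mi : measurable_fun [set: T] (fun t => ((f t : 'rV[R]_m) - g t) ord0 i).
    rewrite (_ : (fun _ => _) =
      (fun t => (f t : 'rV[R]_m) ord0 i) \- (fun t => (g t : 'rV[R]_m) ord0 i)).
      apply: measurable_funB.
      - exact: measurableT_comp (measurable_coord i) mf.
      - exact: measurableT_comp (measurable_coord i) mg.
    by apply/funext => t; rewrite !mxE.
  exact: measurable_funM.
have := md measurableT `]-oo, a ^+ 2]%classic (measurable_itv _).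
rewrite setTI; congr measurable; apply/seteqP.
by split=> t /=; rewrite in_itv /= enorm_le.
Qed.

Lemma measurable_unit : measurable ([set x | dot x x = 1] : set (borelE R m)).
Proof.
have := measurable_dot (@measurable_id _ (borelE R m) setT)
  (@measurable_id _ (borelE R m) setT).
by move=> /(_ measurableT [set 1] (measurable_set1 _)); rewrite setTI.
Qed.

End Measurability.

Section Sampling.
Context {R : realType} {disp disp' : measure_display} {T : measurableType disp}
  {T' : measurableType disp'}.
Variables (P : probability T R) (n N : nat) (X : 'I_n -> {RV P >-> T'}).
Hypothesis hind : independent_RVs X.

Lemma avoid_prob (B : set T') (mu : R) : measurable B ->
  (forall i, P (X i @^-1` B) = mu%:E) ->
  P [set t | forall i, ~ B (X i t)] = ((1 - mu) ^+ n)%:E.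
Proof.
move=> mB muE.
have -> : [set t | forall i, ~ B (X i t)] =
    \bigcap_(i in [set` [set: 'I_n]%SET]) (X i @^-1` (~` B)).
  by apply/seteqP; split=> t /= h i => [_|]; apply: h => //=; rewrite inE.
rewrite (hind _ (B := fun=> ~` B)); last by move=> _; exact: measurableC.
rewrite (eq_bigr (fun=> (1 - mu)%:E)) => [|i _].
  by rewrite prodEFin big_const cardsT card_ord iter_mulr mulr1.
rewrite preimage_setC probability_setC ?muE //.
by rewrite -[X in measurable X]setTI; exact: measurable_funP.
Qed.

(** For disjoint sets the avoidance events are negatively correlated: 1 - a - b <= (1 - a) (1 - b),
    to the power n. So [second_moment] applies, with mean at least N (1 - beta)^n. *)
Lemma all_hit_prob (B : 'I_N -> set T') (mu : 'I_N -> R) (beta : R) :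
  (forall k, measurable (B k)) ->
  (forall k l, k != l -> B k `&` B l = set0) ->
  (forall i k, P (X i @^-1` B k) = (mu k)%:E) ->
  (forall k, 0 <= mu k <= beta) -> beta < 1 -> (0 < N)%N ->
  (P (~` \bigcup_k [set t | forall i, ~ B k (X i t)]) <=
   ((N%:R * (1 - beta) ^+ n)^-1)%:E)%E.
Proof.
move=> mB dB muE mub b1 N0.
have mpre i A : measurable A -> measurable (X i @^-1` A).
  by move=> mA; rewrite -[X in measurable X]setTI; exact: measurable_funP.
have NE : N%:R * (1 - beta) ^+ n = \sum_(k < N) (1 - beta) ^+ n.
  by rewrite sumr_const card_ord mulr_natl.
have b0 : 0 < 1 - beta by rewrite subr_gt0.
have le1 : N%:R * (1 - beta) ^+ n <= \sum_k (1 - mu k) ^+ n.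
  rewrite NE; apply: ler_sum => k _; have /andP[m0 m1] := mub k.
  by rewrite lerXn2r ?nnegrE; lra.
have N1 : 0 < N%:R * (1 - beta) ^+ n.
  by rewrite mulr_gt0 ?exprn_gt0 // ltr0n.
apply: (@le_trans _ _ ((\sum_k (1 - mu k) ^+ n)^-1)%:E); last first.
  by rewrite lee_fin lef_pV2 ?posrE // (lt_le_trans N1).
apply: second_moment.
- move=> k; rewrite (_ : [set _ | _] = \bigcap_(i in [set: 'I_n]) (X i @^-1` (~` B k))).
    apply: fin_bigcap_measurable => // i _; apply: mpre; exact: measurableC.
  by apply/seteqP; split=> t /= h i; [move=> _|]; apply: h.
- by move=> k; apply: avoid_prob.
- move=> k l kl.
  have -> : [set t | forall i, ~ B k (X i t)] `&` [set t | forall i, ~ B l (X i t)] =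
      [set t | forall i, ~ (B k `|` B l) (X i t)].
    apply/seteqP; split=> [t [h1 h2] i [/h1|/h2] //|t h].
    by split=> i Bi; apply: (h i); [left|right].
  rewrite (@avoid_prob _ (mu k + mu l)); last 2 first.
  + exact: measurableU.
  + move=> i; rewrite preimage_setU measureU //; try exact: mpre.
      exact: (congr2 adde (muE i k) (muE i l)).
    by rewrite -preimage_setI dB // preimage_set0.
  have /andP[m0 m1] := mub k; have /andP[l0 l1] := mub l.
  rewrite lee_fin -exprMn.
  (* A sample point gives mu k + mu l <= 1, which makes the base of the power nonnegative; without
     one, both powers are 1. *)
  have [->|n0] := eqVneq n 0%N; first by rewrite !expr0.
  have : mu k + mu l <= 1.
    have n_gt0 : (0 < n)%N by rewrite lt0n.
    pose i0 : 'I_n := Ordinal n_gt0.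
    rewrite -lee_fin EFinD -(muE i0 k) -(muE i0 l) -measureU; try exact: mpre.
      by apply: probability_le1; apply: measurableU; exact: mpre.
    by rewrite -preimage_setI dB // preimage_set0.
  move=> kl1; rewrite lerXn2r ?nnegrE; try nra.
- exact: lt_le_trans le1.
Qed.

End Sampling.

(** A common point x has x . (p + q) > 2 h, and Cauchy-Schwarz gives 4 h^2 < |p + q|^2 = 2 + 2 p .
    q. The bound is the cosine of the doubled angle. *)
Lemma cap_disjoint (R : realType) (m : nat) (p q x : 'rV[R]_m) h : 0 <= h ->
  dot p p = 1 -> dot q q = 1 -> dot x x = 1 ->
  cap p h x -> cap q h x -> 2 * h ^+ 2 - 1 < dot p q.
Proof.
rewrite /cap /= => h0 p1 q1 x1 hp hq.
have := dot_cauchy x (p + q).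
rewrite x1 !(dotDl, dotDr) p1 q1 (dotC q p).
move: (dot x p) (dot x q) hp hq => a b ha hb.
nra.
Qed.

Section Packing.
Variables (R : realType) (d : nat).
Hypothesis d0 : (0 < d)%N.
Context {disp : measure_display} {T : measurableType disp}.
Variables (P : probability T R) (X : {RV P >-> borelE R d.+1}).
Hypothesis hX : uniform_on_sphere X.

Lemma measurable_pre A : measurable A -> measurable (X @^-1` A).
Proof. by move=> mA; rewrite -[X in measurable X]setTI; exact: measurable_funP. Qed.

Lemma unit_sphere : [set x | dot x x = 1] = @sphere R d.
Proof. by apply/seteqP; split=> x /= /enorm1_dot. Qed.

(** The sphere and the whole space have the same [uniform_law], a quotient that equals 1 because the
    law of X has total mass 1. That the measure of the sphere is positive and finite is thus never
    proved directly. *)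
Lemma sphere_prob : P (X @^-1` [set x | dot x x = 1]) = 1%E.
Proof.
have := hX (@measurable_unit R d.+1); rewrite /distribution /pushforward => ->.
rewrite unit_sphere /uniform_law setIid.
have := hX measurableT; rewrite /distribution /pushforward preimage_setT.
by rewrite probability_setT /uniform_law setTI.
Qed.

Definition cap_bound (h : R) : R := 2^-1 * (Num.sqrt (1 - h ^+ 2) / h) ^+ d.

Lemma cap_prob p h : dot p p = 1 -> 0 < h -> h < 1 ->
  (P (X @^-1` cap p h) <= (cap_bound h)%:E)%E.
Proof.
move=> p1 h0 h1.
have muE A : measurable A -> P (X @^-1` A) = uniform_law A by exact: hX.
have mc := @measurable_cap R d.+1.
rewrite muE //; apply: le_trans (cap_law_lipschitz d0 p1 h0 h1) _.
rewrite /cap_bound [2^-1 * _]mulrC EFinM lee_wpmul2l //.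
  by rewrite lee_fin exprn_ge0 // divr_ge0 ?sqrtr_ge0 // ltW.
have := hemisphere_law_opp p d0; rewrite -!muE //.
have : (P (X @^-1` cap p 0) + P (X @^-1` cap (- p) 0) <= 1)%E.
  rewrite -measureU; try exact/measurable_pre.
    by apply: probability_le1; apply: measurableU; exact: measurable_pre.
  rewrite -preimage_setI (_ : _ `&` _ = set0) ?preimage_set0 //.
  apply/seteqP; split=> // x []; rewrite /cap /= dotNr oppr_gt0 => a b.
  by have := lt_trans a b; rewrite ltxx.
have /fineK <- : P (X @^-1` cap p 0) \is a fin_num.
  by apply: fin_num_measure; exact: measurable_pre.
have /fineK <- : P (X @^-1` cap (- p) 0) \is a fin_num.
  by apply: fin_num_measure; exact: measurable_pre.
by rewrite -EFinD !lee_fin; lra.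
Qed.

Lemma cap_bound_ge0 h : 0 < h -> 0 <= cap_bound h.
Proof.
by move=> h0; rewrite mulr_ge0 // exprn_ge0 // divr_ge0 ?sqrtr_ge0 // ltW.
Qed.

(** Greedy choice: if no further centre fits, the caps of height h around the chosen ones cover the
    sphere, against the union bound on their probabilities. *)
Lemma packing h (N : nat) : 0 < h -> h < 1 -> N%:R * cap_bound h < 1 ->
  exists s : seq 'rV[R]_d.+1, [/\ size s = N.+1,
    forall p, p \in s -> dot p p = 1 &
    pairwise (fun p q => dot p q <= h) s].
Proof.
move=> h0 h1; have b0 := cap_bound_ge0 h0.
elim: N => [_|N IH Nb].
  exists [:: diag R d]; split=> // p; rewrite inE => /eqP ->; exact: dot_diag.
have [|s [sN s1 sh]] := IH; first by move: Nb; rewrite -natr1; lra.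
suff [q q1 qs] : exists2 q, dot q q = 1 & forall p, p \in s -> dot q p <= h.
  exists (q :: s); split=> [|p|]; first by rewrite /= sN.
    by rewrite inE => /predU1P[->|/s1].
  by rewrite /= sh andbT; apply/allP.
apply: contrapT => nq.
have cover : X @^-1` [set x | dot x x = 1] `<=`
    \big[setU/set0]_(i < N.+1) (X @^-1` cap (nth 0 s i) h).
  move=> t /= t1; apply: contrapT => nt; apply: nq.
  exists (X t) => // p ps; rewrite leNgt; apply/negP => hp; apply: nt.
  have ip : (index p s < N.+1)%N by rewrite -sN index_mem.
  rewrite -(bigcup_mkord _ (fun i => X @^-1` cap (nth 0 s i) h)).
  exists (index p s) => //=.
  by rewrite /cap /= nth_index.
have mc i : measurable (X @^-1` cap (nth 0 s i) h).
  apply: measurable_pre; exact: measurable_cap.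
have := Boole_inequality P (A := fun i => X @^-1` cap (nth 0 s i) h) (n := N.+1)
  (fun i _ => mc i).
apply/negP; rewrite -ltNge; apply: (@lt_le_trans _ _ 1%E); last first.
  rewrite -sphere_prob; apply: le_measure; rewrite ?inE //.
    apply: measurable_pre; exact: measurable_unit.
  by apply: bigsetU_measurable => i _; exact: mc.
apply: (@le_lt_trans _ _ (\sum_(i < N.+1) (cap_bound h)%:E)%E).
  apply: lee_sum => i _; apply: cap_prob => //.
  by apply: s1; rewrite mem_nth // sN.
by rewrite sumEFin lte_fin sumr_const card_ord -mulr_natl.
Qed.

End Packing.

(** * Proper colourings from an empty cap *)

Section Chromatic.

Lemma chromatic_number_le (V : finType) (G : sgraph V) k :
  (chromatic_number G <= k)%N = colorable G k.
Proof.
rewrite /chromatic_number; case: ex_minnP => c Gc cmin.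
apply/idP/idP => [ck|/cmin //].
have /existsP[f /forallP fP] := Gc.
apply/existsP; exists [ffun x => widen_ord ck (f x)].
apply/forallP => x; apply/forallP => y; apply/implyP => xy.
have := forallP (fP x) y; rewrite xy /= !ffunE; apply: contra_neq.
by move=> /(congr1 val) /= /val_inj.
Qed.

Variables (R : realType) (d n : nat).
Context {disp : measure_display} {T : measurableType disp}.
Variables (P : probability T R) (X : 'I_n -> {RV P >-> borelE R d.+1}).

(** A finite union, over all colourings, of finite intersections of distance conditions. *)
Lemma measurable_chromatic (eps : R) (k : nat) :
  measurable [set t | (chromatic_number (Bor eps (fun i => X i t)) <= k)%N].
Proof.
have -> : [set t | (chromatic_number (Bor eps (fun i => X i t)) <= k)%N] =
  \bigcup_(f in [set: {ffun 'I_n -> 'I_k}]) \bigcap_(ij in [set: 'I_n * 'I_n])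
    (if (ij.1 == ij.2) || (f ij.1 != f ij.2) then setT
     else [set t | enorm ((X ij.1 t : 'rV[R]_d.+1) - X ij.2 t) <= 2 - eps]).
  apply/seteqP; split=> t /=; rewrite chromatic_number_le.
    move=> /existsP[f /forallP fP]; exists f => // -[i j] _ /=.
    have := forallP (fP i) j; rewrite /= /borsuk_rel.
    case: eqVneq => //= ij; case: eqVneq => //= fij.
    by rewrite implybF -leNgt.
  move=> [f _ fP]; apply/existsP; exists f.
  apply/forallP => i; apply/forallP => j; apply/implyP => /andP[ij eij].
  apply/eqP => fij; have := fP (i, j) I; rewrite /= fij eqxx orbF (negPf ij) /=.
  by rewrite leNgt eij.
apply: fin_bigcup_measurable; first exact: finite_finset.
move=> f _; apply: fin_bigcap_measurable; first exact: finite_finset.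
by move=> [i j] _ /=; case: ifP => // _; exact: measurable_dist.
Qed.

Hypothesis hind : independent_RVs X.
Hypothesis hunif : forall i, uniform_on_sphere (X i).

(** Packing at height 2 h^2 - 1 provides N + 1 disjoint caps of height h. The subtracted term bounds
    the probability that all of them are hit. *)
Lemma chromatic_prob (h eps : R) (N : nat) : (0 < d)%N -> (0 < n)%N ->
  0 < h -> h < 1 -> 0 < 2 * h ^+ 2 - 1 -> eps <= (1 - h ^+ 2) / (4 * d.+1%:R) ->
  cap_bound d h < 1 -> N%:R * cap_bound d (2 * h ^+ 2 - 1) < 1 ->
  ((1 - (N.+1%:R * (1 - cap_bound d h) ^+ n)^-1)%:E <=
   P [set t | (chromatic_number (Bor eps (fun i => X i t)) <= d.+1)%N])%E.
Proof.
move=> d0 n0 h0 h1 h2 heps c1 Nc.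
pose i0 : 'I_n := Ordinal n0.
have h21 : 2 * h ^+ 2 - 1 < 1 by nra.
have [s [sN s1 sh]] := packing d0 (hunif i0) h2 h21 Nc.
pose U : set (borelE R d.+1) := [set x | dot x x = 1].
have mU : measurable U by exact: measurable_unit.
pose p (k : 'I_N.+1) := nth 0 s k.
have p1 k : dot (p k) (p k) = 1 by apply: s1; rewrite mem_nth // sN.
(* The half-spaces are disjoint only within the sphere. *)
pose B (k : 'I_N.+1) : set (borelE R d.+1) := cap (p k) h `&` U.
have mB k : measurable (B k) by apply: measurableI => //; exact: measurable_cap.
have dB k l : k != l -> B k `&` B l = set0.
  wlog kl : k l / (k < l)%N => [hw|_].
    case: (ltngtP k l) => [kl|lk|/val_inj ->]; last by rewrite eqxx.
      exact: hw.
    by rewrite eq_sym setIC; exact: hw.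
  apply/seteqP; split=> // x [[xk xU] [xl _]].
  have := cap_disjoint (ltW h0) (p1 k) (p1 l) xU xk xl.
  apply/negP; rewrite -leNgt.
  by have /(pairwiseP 0) := sh; apply => //; rewrite inE sN.
have muE i k : P (X i @^-1` B k) = (fine (P (X i0 @^-1` B k)))%:E.
  rewrite fineK; last by apply: fin_num_measure; exact: measurable_pre.
  have E j : P (X j @^-1` B k) = uniform_law (B k) by exact: hunif.
  by rewrite !E.
have cb k : 0 <= fine (P (X i0 @^-1` B k)) <= cap_bound d h.
  rewrite fine_ge0 //= -lee_fin -(muE i0).
  apply: le_trans (cap_prob d0 (hunif i0) (p1 k) h0 h1).
  apply: le_measure; rewrite ?inE; try exact: measurable_pre.
    by apply: measurable_pre; exact: measurable_cap.
  by move=> t [].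
have hit := all_hit_prob hind mB dB muE cb c1 isT.
set E := \bigcup_k _ in hit.
have mE : measurable E.
  apply: fin_bigcup_measurable => // k _.
  rewrite (_ : [set _ | _] = \bigcap_(i in [set: 'I_n]) (X i @^-1` (~` B k))).
    apply: fin_bigcap_measurable => // i _; apply: measurable_pre; exact: measurableC.
  by apply/seteqP; split=> t /= h' i; [move=> _|]; apply: h'.
set G := [set t | _].
have mG : measurable G by exact: measurable_chromatic.
(* The sample lies on the sphere only almost surely; the null exception is added to the bad
   event. *)
have onU : P [set t | forall i, ~ (~` U) (X i t)] = 1%E.
  rewrite (avoid_prob hind (mu := 0)) ?subr0 ?expr1n //; first exact: measurableC.
  move=> i; rewrite -preimage_setC probability_setC ?sphere_prob ?subee //.
  exact: measurable_pre.
set A := [set t | _] in onU.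
have mA : measurable A.
  rewrite (_ : A = \bigcap_(i in [set: 'I_n]) (X i @^-1` U)).
    by apply: fin_bigcap_measurable => // i _; exact: measurable_pre.
  apply/seteqP; split=> t /= h' i; first by move=> _; apply: contrapT (h' i).
  by move=> /(_ (h' i I)).
have GE : ~` G `<=` ~` A `|` ~` E.
  rewrite -setCI; apply: subsetC => t [At [k _ Ekt]].
  rewrite /G /= chromatic_number_le; apply/existsP.
  have Ut i : dot (X i t : 'rV[R]_d.+1) (X i t) = 1 by apply: contrapT (At i).
  have Xh i : dot (X i t : 'rV[R]_d.+1) (p k) <= h.
    by rewrite leNgt; apply/negP => hi; apply: (Ekt i); split.
  exists [ffun i => colour (p k) (X i t)].
  apply/forallP => i; apply/forallP => j; apply/implyP => /andP[ij].
  rewrite !ffunE; apply: contraTneq => cij; rewrite -leNgt.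
  apply: le_trans (same_colour_dist (p1 k) h0 (ltW h1) (Ut i) (Ut j) (Xh i) (Xh j) cij) _.
  by rewrite lerD2l lerN2.
have PG : (P (~` G) <= ((N.+1%:R * (1 - cap_bound d h) ^+ n)^-1)%:E)%E.
  apply: (@le_trans _ _ (P (~` A `|` ~` E))).
    apply: le_measure; rewrite ?inE //; first exact: measurableC.
    by apply: measurableU; exact: measurableC.
  apply: le_trans (measureU2 _ _ _) _; try exact: measurableC.
  by rewrite [X in (X + _)%E]probability_setC // onU subee // add0e.
have fG : P G \is a fin_num by exact: fin_num_measure.
move: PG; rewrite probability_setC // -(fineK fG) -EFinB !lee_fin.
by move=> PG; rewrite lerBlDr -lerBlDl.
Qed.

End Chromatic.

(** * Lower bound for lambda *)

Section Simplex.
Variables (R : realType) (d : nat) (v : 'I_d.+2 -> 'rV[R]_d.+1).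
Hypothesis hv : regular_inscribed_simplex v.

(* The d+2 vertices are linearly dependent; pairing a dependency with each
   vertex shows that its coefficients are equal. *)
Lemma dot_vertices i j : i != j -> dot (v i) (v j) = - d.+1%:R^-1.
Proof.
case: hv => v1 [s s0 vs].
have {}v1 k : dot (v k) (v k) = 1 by apply/enorm1_dot; exact: v1.
pose rho := 1 - s ^+ 2 / 2.
have vd k l : k != l -> dot (v k) (v l) = rho.
  move=> kl; have := sqr_enorm (v k - v l); rewrite vs //.
  by rewrite !(dotDl, dotDr, dotNl, dotNr) !v1 (dotC (v l)) /rho => ->; field.
move=> ij; rewrite (vd _ _ ij).
pose M := \matrix_(k < d.+2) v k.
have nM : ~~ row_free M by rewrite -row_leq_rank -ltnNge ltnS rank_leq_col.
have [c c0 cM] : exists2 c : 'rV[R]_d.+2, c != 0 & c *m M = 0.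
  move: nM; rewrite -kermx_eq0 => /rowV0Pn[c cK c0]; exists c => //.
  exact/sub_kermxP.
have cv : \sum_k c ord0 k *: v k = 0.
  rewrite -[RHS]cM mulmx_sum_row; apply: eq_bigr => k _; rewrite rowK.
  by congr (_ *: _).
have rel l : (1 - rho) * c ord0 l + rho * \sum_k c ord0 k = 0.
  have := congr1 (dot (v l)) cv; rewrite dot_sumr [RHS]dotC dot0l => cl.
  rewrite -[RHS]cl.
  rewrite [X in _ = X](bigD1 l) // [X in rho * X](bigD1 l) //=.
  rewrite dotZr v1 mulrDr mulr_sumr.
  rewrite [X in _ = _ + X](eq_bigr (fun k => rho * c ord0 k)) => [|k kl].
    by ring.
  by rewrite dotZr vd 1?eq_sym // mulrC.
have r1 : 1 - rho != 0.
  by rewrite /rho opprB addrC subrK mulf_neq0 // ?expf_neq0 ?gt_eqF // invr_gt0.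
have cc l : c ord0 l = c ord0 i.
  by apply: (mulfI r1); apply: (addIr (rho * \sum_k c ord0 k)); rewrite !rel.
have ci0 : c ord0 i != 0.
  apply: contra_neq c0 => ci0; apply/rowP => l; rewrite mxE.
  by rewrite [LHS]cc.
(* With equal nonzero coefficients the relation reads 1 - rho + (d + 2) rho = 0. *)
have := rel i; rewrite (eq_bigr (fun=> c ord0 i)) // sumr_const card_ord.
rewrite -[c ord0 i *+ _]mulr_natl mulrA -mulrDl => /eqP; rewrite mulf_eq0 (negPf ci0) orbF.
move/eqP => e; have D0 : d.+1%:R != 0 :> R by rewrite pnatr_eq0.
apply: (mulIf D0); rewrite mulNr mulVf //.
move: e; rewrite -[d.+2%:R]natr1; move: (d.+1%:R) => D e; lra.
Qed.

End Simplex.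

Section Lambda.
Variables (R : realType) (d : nat) (v : 'I_d.+2 -> 'rV[R]_d.+1).
Hypothesis hv : regular_inscribed_simplex v.
Variable k : 'I_d.+2.

(* Centres of two complementary faces of the facet: the distance of their
   radial projections is the diameter when the faces have nearly equal sizes. *)
Definition face_centre (A : {set 'I_d.+2}) : 'rV[R]_d.+1 :=
  \sum_i (if i \in A then #|A|%:R^-1 else 0) *: v i.

Lemma face_centre_facet (A : {set 'I_d.+2}) :
  k \notin A -> (0 < #|A|)%N -> facet v k (face_centre A).
Proof.
move=> kA A0; exists (fun i => if i \in A then #|A|%:R^-1 else 0); split=> //.
- by move=> i; case: ifP.
- by rewrite (negPf kA).
- rewrite -big_mkcond /= sumr_const -[LHS]mulr_natl divff //.
  by rewrite pnatr_eq0 -lt0n.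
Qed.

(** The Gram matrix of the vertices is (1 + 1 / (d + 1)) times the identity minus 1 / (d + 1) times
    the all-ones matrix, and the weights of each centre sum to 1. *)
Lemma dot_face_centre (A B : {set 'I_d.+2}) : (0 < #|A|)%N -> (0 < #|B|)%N ->
  dot (face_centre A) (face_centre B) =
  #|A :&: B|%:R / (#|A|%:R * #|B|%:R) * (1 + d.+1%:R^-1) - d.+1%:R^-1.
Proof.
move=> A0 B0.
have vv i j : dot (v i) (v j) = (i == j)%:R * (1 + d.+1%:R^-1) - d.+1%:R^-1.
  have [<-|ij] := eqVneq i j; last by rewrite (dot_vertices hv ij) mul0r sub0r.
  rewrite mul1r addrK; by case: hv => /(_ i) /enorm1_dot.
have An : #|A|%:R != 0 :> R by rewrite pnatr_eq0 -lt0n.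
have Bn : #|B|%:R != 0 :> R by rewrite pnatr_eq0 -lt0n.
rewrite /face_centre dot_sumr.
pose w (C : {set 'I_d.+2}) i : R := if i \in C then #|C|%:R^-1 else 0.
have w1 (C : {set 'I_d.+2}) : #|C|%:R != 0 :> R -> \sum_i w C i = 1.
  by move=> C0; rewrite /w -big_mkcond /= sumr_const -[LHS]mulr_natl divff.
rewrite (eq_bigr (fun i => (w A i * w B i) * (1 + d.+1%:R^-1)
    - w B i * d.+1%:R^-1)) => [|i _]; last first.
  rewrite dotZr dotC dot_sumr.
  under eq_bigr do rewrite dotZr vv mulrBr.
  rewrite sumrB -mulr_suml w1 // (bigD1 i) //= eqxx big1 => [|j ji]; last first.
    by rewrite eq_sym (negPf ji) mul0r mulr0.
  by rewrite /= mulr1n -/(w A i) !mul1r addr0 mulrBr mulrA (mulrC (w B i) (w A i)).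
rewrite sumrB -!mulr_suml w1 // mul1r; congr (_ * _ - _).
rewrite (eq_bigr (fun i => if i \in A :&: B then (#|A|%:R * #|B|%:R)^-1 else 0)).
  by rewrite -big_mkcond /= sumr_const -[LHS]mulr_natl.
move=> i _; rewrite /w inE; case: (i \in A); case: (i \in B) => /=;
  by rewrite ?mul0r ?mulr0 // invfM.
Qed.

Lemma lambda_ge (x y : 'rV[R]_d.+1) : facet v k x -> facet v k y ->
  enorm (radial x - radial y) <= lambda v k.
Proof.
move=> fx fy; apply: ub_le_sup; last first.
  by exists (radial x, radial y) => //; split; [exists x | exists y].
have r1 (z : 'rV[R]_d.+1) : dot (radial z) (radial z) <= 1.
  rewrite /radial dotZl dotZr mulrA -expr2 exprVn -sqr_enorm.
  (* [radial] sends 0 to 0, so the bound 1 holds at the origin too. *)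
  have [->|z0] := eqVneq (enorm z) 0; first by rewrite expr0n mulr0.
  by rewrite mulVf // expf_neq0.
exists 2 => _ [[_ _] [[a _ <-] [b _ <-]] <-] /=.
rewrite enorm_le //; have := r1 a; have := r1 b.
have := dot_ge0 (radial a + radial b).
move: (radial a) (radial b) => {}a {}b.
rewrite !(dotDl, dotDr, dotNl, dotNr) (dotC b a); lra.
Qed.

(** With a and b the two halves of d + 1, the squared distance of the projected centres x, y is 2 +
    2 / ((d + 1) |x| |y|), and |x| |y| <= (d + 2) / (d (d + 1)). *)
Lemma lambda_lower_bound : (0 < d)%N -> 4 - lambda v k ^+ 2 <= 4 / d.+2%:R.
Proof.
move=> d0.
pose a := (d.+1)./2; pose b := uphalf d.+1.
have ab : (a + b = d.+1)%N by rewrite /a /b; lia.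
have a0 : (0 < a)%N by rewrite /a; lia.
have b0 : (0 < b)%N by rewrite /b; lia.
have near : a = b \/ b = a.+1 by rewrite /a /b; lia.
clearbody a b.
have cK : #|[set~ k]%SET| = d.+1 by rewrite cardsC1 card_ord.
have /card_gt0P[B] :
    (0 < #|[set B : {set 'I_d.+2} | B \subset [set~ k]%SET & #|B| == b]%SET|)%N.
  by rewrite cards_draws cK bin_gt0; lia.
rewrite inE => /andP[Bk /eqP cB].
pose A := ([set~ k] :\: B)%SET.
have cA : #|A| = a.
  have := cardsID B [set~ k]%SET; rewrite (finset.setIidPr Bk) cK cB => e.
  by apply: (@addnI b); rewrite e -ab addnC.
have AB : (A :&: B)%SET = finset.set0.
  by apply/setP => i; rewrite !inE; case: (i \in B); rewrite ?andbF.
have kB : k \notin B.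
  by apply/negP => kB; have := fintype.subsetP Bk _ kB; rewrite !inE eqxx.
have kA : k \notin A by rewrite !inE eqxx andbF.
set x := face_centre A; set y := face_centre B.
have fx : facet v k x by apply: face_centre_facet; rewrite ?cA.
have fy : facet v k y by apply: face_centre_facet; rewrite ?cB.
have xx : dot x x = b.+1%:R / (a%:R * d.+1%:R).
  rewrite dot_face_centre ?cA // finset.setIid cA -ab -!natr1 natrD.
  have : 0 < a%:R :> R by rewrite ltr0n.
  have : 0 < b%:R :> R by rewrite ltr0n.
  by move=> pb pa; field; rewrite !gt_eqF //; lra.
have yy : dot y y = a.+1%:R / (b%:R * d.+1%:R).
  rewrite dot_face_centre ?cB // finset.setIid cB -ab -!natr1 natrD.
  have : 0 < a%:R :> R by rewrite ltr0n.
  have : 0 < b%:R :> R by rewrite ltr0n.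
  by move=> pb pa; field; rewrite !gt_eqF //; lra.
have xy : dot x y = - d.+1%:R^-1.
  by rewrite dot_face_centre ?cA ?cB // AB cards0 !mul0r sub0r.
have D0 : 0 < d.+1%:R :> R by rewrite ltr0n.
have d0' : 0 < d%:R :> R by rewrite ltr0n.
have pa : 0 < a%:R :> R by rewrite ltr0n.
have pb : 0 < b%:R :> R by rewrite ltr0n.
have x0 : 0 < enorm x by rewrite enorm_dot xx sqrtr_gt0 divr_gt0 ?mulr_gt0 // ltr0n.
have y0 : 0 < enorm y by rewrite enorm_dot yy sqrtr_gt0 divr_gt0 ?mulr_gt0 // ltr0n.
have xyP : enorm x * enorm y <= d.+2%:R / (d%:R * d.+1%:R).
  rewrite -ler_sqr ?nnegrE; last 2 first.
  - by rewrite mulr_ge0 ?enorm_ge0.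
  - by rewrite divr_ge0 ?mulr_ge0.
  rewrite exprMn !sqr_enorm xx yy.
  have -> : b.+1%:R / (a%:R * d.+1%:R) * (a.+1%:R / (b%:R * d.+1%:R)) =
     (a.+1 * b.+1)%:R / (a * b)%:R / d.+1%:R ^+ 2 :> R.
    by rewrite !natrM; field; rewrite !gt_eqF.
  have -> : (d.+2%:R / (d%:R * d.+1%:R)) ^+ 2 =
     (d.+2 ^ 2)%:R / (d ^ 2)%:R / d.+1%:R ^+ 2 :> R.
    by rewrite !natrX; field; rewrite !gt_eqF.
  rewrite ler_pM2r ?invr_gt0 ?exprn_gt0 //.
  rewrite ler_pdivrMr ?ltr0n ?muln_gt0 ?a0 // mulrAC.
  rewrite ler_pdivlMr ?ltr0n ?expn_gt0 ?d0 // -!natrM ler_nat.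
  (* 4 a b = (d + 1)^2 - (b - a)^2 with b - a at most 1. *)
  have : (d * d.+2 <= 4 * (a * b))%N.
    by case: near => e; rewrite e in ab *; nia.
  nia.
have := lambda_ge fx fy.
have l0 := enorm_ge0 (radial x - radial y).
move=> hl; have : enorm (radial x - radial y) ^+ 2 <= lambda v k ^+ 2.
  by rewrite ler_sqr ?nnegrE // (le_trans l0).
rewrite sqr_enorm.
have -> : dot (radial x - radial y) (radial x - radial y) =
    2 + 2 * (d.+1%:R^-1 / (enorm x * enorm y)).
  rewrite /radial !(dotDl, dotDr, dotNl, dotNr, dotZl, dotZr) (dotC y x).
  rewrite xy -!sqr_enorm; field; rewrite !gt_eqF //.
have : d%:R / d.+2%:R <= d.+1%:R^-1 / (enorm x * enorm y).
  rewrite ler_pdivlMr ?mulr_gt0 // mulrAC ler_pdivrMr ?ltr0n //.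
  have -> : d.+1%:R^-1 * d.+2%:R = d%:R * (d.+2%:R / (d%:R * d.+1%:R)) :> R.
    by field; rewrite !gt_eqF.
  by rewrite ler_pM2l.
have -> : d%:R / d.+2%:R = 1 - 2 / d.+2%:R :> R.
  by rewrite -[d.+2%:R]natr1 -[d.+1%:R]natr1; field; rewrite gt_eqF //; lra.
move: (_^-1 / _) => Z.
have -> : 4 / d.+2%:R = 2 * (2 / d.+2%:R) :> R by rewrite mulrA; congr (_ / _); ring.
move: (2 / _) => W; lra.
Qed.

End Lambda.

(** * Asymptotics *)

Section Asymptotics.
Variable R : realType.

Lemma bernoulli_ge (t : R) n : 0 <= t -> t <= 1 -> 1 - n%:R * t <= (1 - t) ^+ n.
Proof.
move=> t0 t1; elim: n => [|n IH]; first by rewrite mul0r subr0 expr0.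
rewrite exprS -natr1; have n0 : 0 <= n%:R :> R by [].
apply: (@le_trans _ _ ((1 - t) * (1 - n%:R * t))).
  have : 0 <= n%:R * (t * t) by apply: mulr_ge0 => //; exact: mulr_ge0.
  lra.
by rewrite ler_wpM2l // subr_ge0.
Qed.

Lemma expR_inv_le_1B (y : R) : y < 1 -> expR (- (y / (1 - y))) <= 1 - y.
Proof.
move=> y1; have y0 : 0 < 1 - y by lra.
rewrite expRN -[leRHS]invrK lef_pV2 ?posrE ?expR_gt0 ?invr_gt0 //.
apply: le_trans (expR_ge1Dx _); rewrite le_eqVlt; apply/orP; left.
by apply/eqP; field; rewrite gt_eqF.
Qed.

(* s is the sine of the angular radius of the cap of height h; the cap of twice
   that radius has height 2 h^2 - 1. *)
Lemma cap_bound_small d (s : R) : (0 < d)%N -> 0 < s -> 6 * d%:R * s ^+ 2 <= 1 ->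
  let h := Num.sqrt (1 - s ^+ 2) in
  [/\ 0 < h, h < 1, h ^+ 2 = 1 - s ^+ 2, cap_bound d h <= 3 / 5 * s ^+ d
    & 0 < 2 * h ^+ 2 - 1 /\ cap_bound d (2 * h ^+ 2 - 1) <= 2 ^+ d * s ^+ d].
Proof.
move=> d0 s0 hs h.
have d1 : 1 <= d%:R :> R by rewrite ler1n.
have s20 : 0 < s ^+ 2 by rewrite exprn_gt0.
have s21 : 6 * s ^+ 2 <= 1.
  by apply: le_trans hs; rewrite ler_pM2r // ler_peMr.
have hh : h ^+ 2 = 1 - s ^+ 2 by rewrite sqr_sqrtr //; lra.
have h0 : 0 < h by rewrite sqrtr_gt0; lra.
have h1 : h < 1 by rewrite -(@expr_lt1 _ 2) ?(ltW h0) // hh; lra.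
have sd0 : 0 < s ^+ d by rewrite exprn_gt0.
rewrite hh; have -> : 2 * (1 - s ^+ 2) - 1 = 1 - 2 * s ^+ 2 by ring.
split=> //.
  rewrite /cap_bound hh subKr sqrtr_sqr gtr0_norm // expr_div_n.
  (* Bernoulli with d s^2 <= 1/6, through h^d >= (h^2)^d. The factor 1/2 of [cap_bound] then becomes
     3/5. *)
  have h56 : 5 / 6 <= h ^+ d.
    apply: (@le_trans _ _ ((1 - s ^+ 2) ^+ d)); last first.
      by rewrite -hh lerXn2r ?nnegrE ?exprn_ge0 ?(ltW h0) // expr2 ler_piMl // ltW.
    by apply: le_trans (bernoulli_ge _ _ _); lra.
  rewrite mulrA ler_pdivrMr ?exprn_gt0 //.
  have : 5 / 6 * s ^+ d <= h ^+ d * s ^+ d by rewrite ler_pM2r.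
  move: (s ^+ d) (h ^+ d) => ? ?; lra.
split; first by lra.
have k0 : 0 < 1 - 2 * s ^+ 2 by lra.
rewrite /cap_bound.
have k23 : 2 / 3 <= (1 - 2 * s ^+ 2) ^+ d.
  by apply: le_trans (bernoulli_ge _ _ _); lra.
(* The sine of the doubled angle: 1 - (1 - 2 s^2)^2 = 4 s^2 - 4 s^4. *)
have : Num.sqrt (1 - (1 - 2 * s ^+ 2) ^+ 2) <= 2 * s.
  rewrite -[leRHS]gtr0_norm ?mulr_gt0 // -sqrtr_sqr ler_wsqrtr //.
  have -> : (2 * s) ^+ 2 = 4 * s ^+ 2 by ring.
  by have := sqr_ge0 (s ^+ 2); lra.
move=> /(lerXn2r d); rewrite ?nnegrE sqrtr_ge0 mulr_ge0 ?(ltW s0) //.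
move=> /(_ isT isT); rewrite [(2 * s) ^+ d]exprMn => hsq.
rewrite expr_div_n [2^-1 * _]mulrA.
rewrite ler_pdivrMr ?exprn_gt0 //.
have : 2 / 3 * (2 ^+ d * s ^+ d) <= (1 - 2 * s ^+ 2) ^+ d * (2 ^+ d * s ^+ d).
  by rewrite ler_wpM2r // mulr_ge0 ?exprn_ge0 // ltW.
have : 0 <= 2 ^+ d * s ^+ d by rewrite mulr_ge0 ?exprn_ge0 // ltW.
move: hsq; move: (2 ^+ d * s ^+ d) ((1 - _) ^+ d) (Num.sqrt _ ^+ d) => a b c.
lra.
Qed.

(** Since L = (ln n) / n <= 4 / ln n, the term 72 forces L <= 1/18, and the other one forces s <= r
    = 1 / sqrt (6 d), the smallness required by [cap_bound_small]. *)
Definition threshold d : R := 72 + 6 / Num.sqrt (6 * d%:R)^-1 ^+ d.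

(* With L = (ln n) / n, the cap has s ^+ d = (3 / (2 d)) L, hence measure at most
   0.9 L, so that each cap is empty with probability at least n ^ (- 0.95), while
   the number of disjoint caps is of order 1 / L. *)
Lemma cap_parameters d n (C : R) : (0 < d)%N -> (0 < n)%N ->
  threshold d <= ln n%:R ->
  C <= (4 * d.+1%:R)^-1 * (9 / (4 * d%:R ^+ 2)) `^ (1 / d%:R) ->
  exists h N,
    [/\ [/\ 0 < h, h < 1 & 0 < 2 * h ^+ 2 - 1],
      C * (ln n%:R / n%:R) `^ (2 / d%:R) <= (1 - h ^+ 2) / (4 * d.+1%:R),
      cap_bound d h < 1,
      N%:R * cap_bound d (2 * h ^+ 2 - 1) < 1
    & ln n%:R / (80 ^+ 2 * 2 ^+ d) <= N.+1%:R * (1 - cap_bound d h) ^+ n].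
Proof.
move=> d0 n0 + hC; set u := ln n%:R => hu.
have d1 : 1 <= d%:R :> R by rewrite ler1n.
have n0' : 0 < n%:R :> R by rewrite ltr0n.
have dn0 : d%:R != 0 :> R by rewrite pnatr_eq0 -lt0n.
pose r := Num.sqrt (6 * d%:R)^-1 : R.
have r0 : 0 < r by rewrite sqrtr_gt0 invr_gt0; lra.
have rd0 : 0 < 6 / r ^+ d by rewrite divr_gt0 ?exprn_gt0.
rewrite /threshold -/r in hu.
have u0 : 0 < u by lra.
have nE : n%:R = expR u by rewrite lnK.
pose L := u / n%:R.
have L0 : 0 < L by rewrite divr_gt0.
have LuE : L <= 4 / u.
  rewrite /L ler_pdivrMr // mulrAC ler_pdivlMr // -expr2 nE.
  have -> : expR u = expR (u / 2) ^+ 2 by rewrite -expRM_natl; congr expR; field.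
  have : (u / 2) ^+ 2 <= expR (u / 2) ^+ 2.
    have := expR_ge1Dx (u / 2); have := expR_gt0 (u / 2) => e0 e1.
    by rewrite ler_sqr ?nnegrE; lra.
  by rewrite expr_div_n; move: (u ^+ 2) (_ ^+ 2) => ? ?; lra.
have L18 : L <= 1 / 18.
  apply: le_trans LuE _; rewrite ler_pdivrMr //; lra.
(* The value of s^d; its square (9 / (4 d^2)) L^2 gives, to the power 1 / d, the factors in the
   bound on C and in epsilon. *)
pose x := 3 / (2 * d%:R) * L.
have x0 : 0 < x by rewrite mulr_gt0 // divr_gt0 // mulr_gt0 // (lt_le_trans _ d1).
have xL : x <= 3 / 2 * L.
  by rewrite ler_pM2r // invfM mulrA ler_piMr // invf_le1 // (lt_le_trans _ d1).
have xr : x <= r ^+ d.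
  apply: le_trans xL _; apply: (@le_trans _ _ (6 / u)).
    have : 3 / 2 * L <= 3 / 2 * (4 / u) by rewrite ler_pM2l.
    by move: (u^-1) => ?; lra.
  rewrite ler_pdivrMr // mulrC -ler_pdivrMr ?exprn_gt0 //; lra.
pose s := x `^ d%:R^-1.
have s0 : 0 < s by rewrite powR_gt0.
have sd : s ^+ d = x by rewrite -powR_mulrn ?ltW // -powRrM mulVf // powRr1 // ltW.
have sr : s <= r by rewrite -(@ler_pXn2r _ d) ?nnegrE ?(ltW s0) ?(ltW r0) ?sd.
have hs : 6 * d%:R * s ^+ 2 <= 1.
  rewrite mulrC -ler_pdivlMr; last by lra.
  rewrite mul1r -[leRHS]sqr_sqrtr; last by rewrite invr_ge0; lra.
  by rewrite ler_sqr ?nnegrE ?(ltW s0) ?(ltW r0).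
have [] := cap_bound_small d0 s0 hs.
set h := Num.sqrt _ => h0 h1 hh hb [k0 kb].
rewrite sd in hb kb.
(* A cap of the doubled radius has measure at most 2^d x <= (3/2) 2^d L <= c L, so N = floor (1 / (2
   c L)) of them fill at most half of the sphere. *)
pose c : R := 2 ^+ d.+1.
have c0 : 0 < c by rewrite exprn_gt0.
have cL0 : 0 < (2 * c * L)^-1.
  by rewrite invr_gt0; apply: mulr_gt0 => //; exact: mulr_gt0.
have bL : cap_bound d h <= 9 / 10 * L by lra.
exists h, (Num.truncn (2 * c * L)^-1); split=> //.
- rewrite hh subKr.
  apply: (@le_trans _ _ ((4 * d.+1%:R)^-1 *
      (9 / (4 * d%:R ^+ 2)) `^ (1 / d%:R) * L `^ (2 / d%:R))).
    by rewrite ler_wpM2r // powR_ge0.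
  rewrite -mulrA [leRHS]mulrC ler_wpM2l ?invr_ge0 ?mulr_ge0 //.
  have -> : 9 / (4 * d%:R ^+ 2) = (3 / (2 * d%:R)) `^ 2%:R :> R.
    rewrite powR_mulrn ?divr_ge0 ?mulr_ge0 //.
    by rewrite expr_div_n exprMn; congr (_ / (_ * _)); ring.
  rewrite -powRrM mul1r -powRM ?(ltW L0) ?divr_ge0 ?mulr_ge0 ?(ltW u0) //.
  by rewrite -/x mulrC powRrM powR_mulrn // ltW.
- by lra.
- apply: (@le_lt_trans _ _ ((2 * c * L)^-1 * (c * L))).
    apply: ler_pM => //; first exact: cap_bound_ge0.
      by rewrite truncn_le ltW.
    apply: le_trans kb _; rewrite /c exprS.
    have : 2 ^+ d * x <= 2 ^+ d * (3 / 2 * L) by rewrite ler_pM2l // exprn_gt0.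
    have : 0 < 2 ^+ d * L by rewrite mulr_gt0 // exprn_gt0.
    by move: (2 ^+ d) => ?; lra.
  have -> : (2 * c * L)^-1 * (c * L) = 1 / 2 by field; rewrite !gt_eqF.
  lra.
- set N := Num.truncn _.
  have NL : (2 * c * L)^-1 <= N.+1%:R by rewrite ltW // truncnS_gt.
  have q : expR (- (19 / 20 * u)) <= (1 - cap_bound d h) ^+ n.
    apply: (@le_trans _ _ (expR (- (19 / 20 * L)) ^+ n)).
      rewrite -expRM_natl ler_expR mulrN lerN2 /L.
      by rewrite le_eqVlt; apply/orP; left; apply/eqP; field; rewrite gt_eqF.
    rewrite lerXn2r ?nnegrE ?expR_ge0 //; first by lra.
    apply: (@le_trans _ _ (1 - 9 / 10 * L)); last by lra.
    apply: le_trans (expR_inv_le_1B _); last by lra.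
    rewrite ler_expR lerN2 ler_pdivrMr; last by lra.
    (* L <= 1/18 makes 0.9 L / (1 - 0.9 L) at most 0.95 L. *)
    have : 0 <= L * (1 - 18 * L) by apply: mulr_ge0; [exact: ltW | lra].
    lra.
  apply: (@le_trans _ _ ((2 * c * L)^-1 * expR (- (19 / 20 * u)))); last first.
    by apply: ler_pM; rewrite ?(ltW cL0) ?expR_ge0.
  (* As n = e^u, the power n^(1/20) = e^(u / 20) is left, and it is at least (u / 40)^2. *)
  have -> : (2 * c * L)^-1 * expR (- (19 / 20 * u)) = expR (u / 20) / (2 * c * u).
    have -> : expR (u / 20) = n%:R * expR (- (19 / 20 * u)).
      by rewrite nE -expRD; congr expR; field.
    by rewrite /L; field; rewrite !gt_eqF.
  rewrite ler_pdivlMr ?mulr_gt0 //.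
  have -> : u / (80 ^+ 2 * 2 ^+ d) * (2 * c * u) = (u / 40) ^+ 2.
    by rewrite /c [2 ^+ d.+1]exprS; field; rewrite expf_neq0.
  have -> : expR (u / 20) = expR (u / 40) ^+ 2 by rewrite -expRM_natl; congr expR; field.
  have := expR_ge1Dx (u / 40); have := expR_gt0 (u / 40) => e0 e1.
  by rewrite ler_sqr ?nnegrE; lra.
Qed.

End Asymptotics.

Theorem theorem3 (R : realType) (d : nat) (hd : (1 <= d)%N)
    (v : 'I_d.+2 -> 'rV[R]_d.+1) (hv : regular_inscribed_simplex v)
    (k : 'I_d.+2) (C : R)
    (hC : C < 3 * (4 - lambda v k ^+ 2) / 64
              * (9 / (4 * d%:R ^+ 2)) `^ (1 / d%:R))
    (disp : nat -> measure_display)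
    (T : forall n : nat, measurableType (disp n))
    (P : forall n : nat, probability (T n) R)
    (X : forall n : nat, 'I_n -> {RV (P n) >-> borelE R d.+1})
    (hind : forall n : nat, independent_RVs (X n))
    (hunif : forall (n : nat) (i : 'I_n), uniform_on_sphere (X n i)) :
  P n [set t : T n |
       (chromatic_number
          (Bor (C * (ln n%:R / n%:R) `^ (2 / d%:R)) (fun i => X n i t))
        <= d.+1)%N] @[n --> \oo] --> 1%E.
Proof.
have hC' : C <= (4 * d.+1%:R)^-1 * (9 / (4 * d%:R ^+ 2)) `^ (1 / d%:R).
  apply: le_trans (ltW hC) _; rewrite ler_wpM2r ?powR_ge0 //.
  have := lambda_lower_bound hv k hd.
  (* 3 / (16 (d + 2)) is below 1 / (4 (d + 1)). *)
  move=> hl; apply: (@le_trans _ _ (3 * (4 / d.+2%:R) / 64)).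
    by rewrite ler_pM2r // ler_pM2l.
  rewrite -[d.+2%:R]natr1; have : 0 < d.+1%:R :> R by rewrite ltr0n.
  move: (d.+1%:R) => D D0.
  rewrite -[leRHS]mul1r ler_pdivlMr ?mulr_gt0 // mulrA mulrAC ler_pdivrMr //.
  by rewrite mulrAC ler_pdivrMr; lra.
have lnoo (a : R) : \forall n \near \oo, a <= ln n%:R.
  near=> n; rewrite -(expRK a) ler_ln ?posrE ?expR_gt0 //.
    by near: n; exact: nbhs_infty_ger.
  by rewrite ltr0n; near: n; exact: nbhs_infty_gt.
(* The failure probability is at most a constant over ln n. *)
apply: (@squeeze_cvge _ _ _ _
  (fun n => (1 - 80 ^+ 2 * 2 ^+ d * (ln n%:R)^-1)%:E) _ (fun=> 1%E)).
- near=> n.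
  have n0 : (0 < n)%N by near: n; exact: nbhs_infty_gt.
  have u0 : 0 < ln n%:R :> R.
    by apply: (@lt_le_trans _ _ 1) => //; near: n; exact: lnoo.
  have hu : threshold R d <= ln n%:R by near: n; exact: lnoo.
  have [h [N [[h0 h1 h2] heps c1 Nc hN]]] := cap_parameters hd n0 hu hC'.
  rewrite probability_le1 ?andbT; last exact: measurable_chromatic.
  apply: le_trans (chromatic_prob (@hind n) (@hunif n) hd n0 h0 h1 h2 heps c1 Nc).
  have K0 : 0 < 80 ^+ 2 * 2 ^+ d :> R by rewrite mulr_gt0 ?exprn_gt0 ?ltr0n.
  have uK : 0 < ln n%:R / (80 ^+ 2 * 2 ^+ d) :> R by rewrite divr_gt0.
  rewrite lee_fin lerB // -[leRHS]invf_div lef_pV2 ?posrE //.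
  exact: lt_le_trans uK hN.
- apply/fine_cvgP; split; first exact: nearW.
  rewrite -[X in _ --> X]subr0 -[X in _ - X](mulr0 (80 ^+ 2 * 2 ^+ d)).
  apply: cvgB; first exact: cvg_cst.
  apply: cvgMr; apply/gtr0_cvgV0.
    by near=> n; apply: (@lt_le_trans _ _ 1) => //; near: n; exact: lnoo.
  by apply/cvgryPge => a; exact: lnoo.
- exact: cvg_cst.
Unshelve. all: end_near.
Qed.
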